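(* Let $p$ and $p'$ be coprime integers with $0<p<p'$, $p'\ge3$, and let $r_0$ and $s_0$ be the smallest non-negative integers such that $|ps_0-p'r_0|=1$. Let $t$ be the rank of $p'/p$ and let $\mathbf C$ be the $t\times t$ matrix associated with $p'/p$. Then for even $L\ge0$: $$\chi^{p,p'}_{s_0,s_0,s_0+1}(L)=\sum_{\mathbf m}q^{\frac14\mathbf m^T\mathbf C\mathbf m-\frac14L^2}\prod_{j=1}^{t-1}\begin{bmatrix}m_j-\frac12(\mathbf C\mathbf m)_j\\ m_j\end{bmatrix}_q,$$ where the summation is over vectors $\mathbf m=(L,m_1,m_2,\dots,m_{t-1})$ with $m_j\in2\mathbb Z$ and $m_j\ge0$ for $j=1,2,\dots,t-1$.
   Context: Generating function. For integers $1\le a,b,c\le p'-1$, $c=b\pm1$, $L\ge0$, $L+a-b$ even, $\mathcal P^{p,p'}_{a,b,c}(L)$ is the set of integer sequences $h=(h_0,\dots,h_L)$ with $1\le h_i\le p'-1$, $|h_{i+1}-h_i|=1$, $h_0=a$, $h_L=b$; put $h_{L+1}=c$. The band between heights $k$ and $k+1$ ($1\le k\le p'-2$) is even if $\lfloor kp/p'\rfloor=\lfloor (k+1)p/p'\rfloor$ and odd otherwise. For $1\le i\le L$ the vertex $v_i$ (segments $h_{i-1}\to h_i\to h_{i+1}$) has the parity of the band between $h_i$ and $h_{i+1}$; it is straight if $h_{i-1}\ne h_{i+1}$ and a peak otherwise. It is scoring if it is straight and odd, or a peak and even; otherwise non-scoring. With $x_i=\frac{i-(h_i-a)}2$, $y_i=\frac{i+(h_i-a)}2$,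 set $c_i=x_i$ if $v_i$ is scoring and $h_i=h_{i-1}+1$, $c_i=y_i$ if $v_i$ is scoring and $h_i=h_{i-1}-1$, $c_i=0$ if $v_i$ is non-scoring, and $wt(h)=\sum_{i=1}^Lc_i$. Then $\chi^{p,p'}_{a,b,c}(L)=\sum_{h\in\mathcal P^{p,p'}_{a,b,c}(L)}q^{wt(h)}$. (With $r=\lfloor pc/p'\rfloor+(b-c+1)/2$, this also equals $\sum_{\lambda\in\mathbb Z}q^{\lambda^2pp'+\lambda(p'r-pa)}\begin{bmatrix}L\\ \frac{L+a-b}2-p'\lambda\end{bmatrix}_q-\sum_{\lambda\in\mathbb Z}q^{(\lambda p+r)(\lambda p'+a)}\begin{bmatrix}L\\ \frac{L+a-b}2-p'\lambda-a\end{bmatrix}_q$.) Gaussian polynomial: $\begin{bmatrix}A\\ B\end{bmatrix}_q=\frac{\prod_{i=1}^A(1-q^i)}{\prod_{i=1}^B(1-q^i)\prod_{i=1}^{A-B}(1-q^i)}$ for $0\le B\le A$, and $0$ otherwise. Rank and matrix. Let $(c_0,c_1,\dots,c_n)$ be the continued fraction of $p'/p=c_0+1/(c_1+1/(\cdots+1/c_n))$ with $c_i\ge1$ for $0<i<n$ and $c_n\ge2$. Put $t_\mu=-1-\delta_{\mu,n+1}+\sum_{i=0}^{\mu-1}c_i$ for $0\le\mu\le n+1$; the rank is $t=t_{n+1}$. The matrix $\mathbf C$ has rows and columns indexed by $0,\dots,t-1$ and is tri-diagonal: for those entries with indices in range, if $j=t_\mu$ for some $\mu\in\{1,\dots,n\}$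 then $\mathbf C_{j,j-1}=-1$, $\mathbf C_{j,j}=1$, $\mathbf C_{j,j+1}=1$; for all other $j$, $\mathbf C_{j,j-1}=-1$, $\mathbf C_{j,j}=2$, $\mathbf C_{j,j+1}=-1$. The vector $\mathbf m$ (a column vector) has components indexed $0,\dots,t-1$, with $m_0=L$. *)

(* Defs.v *)
From HB Require Import structures.
From mathcomp Require Import all_boot all_order all_algebra.
From mathcomp Require Import boolp classical_sets fsbigop.

Set Implicit Arguments.
Unset Strict Implicit.
Unset Printing Implicit Defensive.

Import Order.TTheory GRing.Theory Num.Theory.
Local Open Scope ring_scope.

(* All identities live in the field Q(q), presented as the fraction field of
   Z[q]; it contains the Laurent polynomials, so integer powers q ^ z make
   sense and the Gaussian polynomial can be written as a quotient. *)
Definition Kq : fieldType := {fraction {poly int}}.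
Definition q : Kq := tofrac ('X : {poly int}).

Definition gauss (A B : int) : Kq :=
  if (0 <= B) && (B <= A) then
    (\prod_(1 <= i < `|A|%N.+1) (1 - q ^+ i)) /
    ((\prod_(1 <= i < `|B|%N.+1) (1 - q ^+ i)) *
     (\prod_(1 <= i < `|A - B|%N.+1) (1 - q ^+ i)))
  else 0.

Section Paths.
Variables (p p' a b c L : nat).

(* A candidate path (h_0, ..., h_L) is an (L+1)-tuple of heights < p'.  The
   default value c of nth makes hgt h L.+1 = c, the extra height h_{L+1}. *)
Definition hgt (h : L.+1.-tuple 'I_p') (i : nat) : nat :=
  nth c (map (@nat_of_ord p') h) i.

Definition is_path (h : L.+1.-tuple 'I_p') : bool :=
  [&& [forall i : 'I_L.+1, (1 <= hgt h i)%N],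
      [forall i : 'I_L, `|(hgt h i.+1)%:Z - (hgt h i)%:Z| == 1],
      hgt h 0 == a & hgt h L == b].

Definition even_band (k : nat) : bool :=
  (k * p %/ p' == k.+1 * p %/ p')%N.

Definition straight (h : L.+1.-tuple 'I_p') (i : nat) : bool :=
  hgt h i.-1 != hgt h i.+1.

Definition scoring (h : L.+1.-tuple 'I_p') (i : nat) : bool :=
  let ev := even_band (minn (hgt h i) (hgt h i.+1)) in
  (straight h i && ~~ ev) || (~~ straight h i && ev).

(* On a path, i - (h_i - a) and i + (h_i - a) are even, so the halves are
   exact. *)
Definition xcoord (h : L.+1.-tuple 'I_p') (i : nat) : int :=
  ((i%:Z - ((hgt h i)%:Z - a%:Z)) %/ 2)%Z.
Definition ycoord (h : L.+1.-tuple 'I_p') (i : nat) : int :=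
  ((i%:Z + ((hgt h i)%:Z - a%:Z)) %/ 2)%Z.

Definition vertex_weight (h : L.+1.-tuple 'I_p') (i : nat) : int :=
  if scoring h i then
    if hgt h i == (hgt h i.-1).+1 then xcoord h i else ycoord h i
  else 0.

Definition wt (h : L.+1.-tuple 'I_p') : int :=
  \sum_(1 <= i < L.+1) vertex_weight h i.

Definition chi : Kq := \sum_(h : L.+1.-tuple 'I_p' | is_path h) q ^ wt h.

End Paths.

Fixpoint cf_val (cs : seq nat) : rat :=
  match cs with
  | [::] => 0
  | [:: c0] => c0%:R
  | c0 :: cs' => c0%:R + 1 / cf_val cs'
  end.

(* cs = [:: c_0; ...; c_n] is the continued fraction of x; thus
   size cs = n + 1. *)
Definition is_cfrac (cs : seq nat) (x : rat) : Prop :=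
  [/\ cf_val cs = x,
      forall i : nat, (0 < i < (size cs).-1)%N -> (1 <= nth 0 cs i)%N
    & (2 <= last 0 cs)%N].

Definition tmu (cs : seq nat) (mu : nat) : int :=
  - 1 - (mu == size cs)%:R + \sum_(0 <= i < mu) (nth 0%N cs i)%:Z.

(* t_{n+1} >= 1 for the continued fraction of p'/p with 0 < p < p', p' >= 3,
   so taking the absolute value only changes the type from int to nat. *)
Definition rank (cs : seq nat) : nat := `|tmu cs (size cs)|%N.

Definition is_turn (cs : seq nat) (j : nat) : bool :=
  [exists mu : 'I_(size cs), (1 <= mu)%N && (j%:Z == tmu cs mu)].

Definition Cmx (cs : seq nat) : 'M[int]_(rank cs) :=
  \matrix_(j < rank cs, k < rank cs)
    if k.+1 == j :> nat then -1
    else if k == j then (if is_turn cs j then 1 else 2)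
    else if k == j.+1 :> nat then (if is_turn cs j then 1 else -1)
    else 0.

(* The component of index 0 is fixed to L without using ord0, since rank cs
   is not syntactically a successor. *)
Definition mset (cs : seq nat) (L : nat) : set 'cV[int]_(rank cs) :=
  [set m : 'cV[int]_(rank cs) | forall j : 'I_(rank cs),
     if j == 0%N :> nat then m j 0 = L%:Z
     else (2 %| (m j 0)%R)%Z /\ 0 <= m j 0]%classic.
Arguments mset : clear implicits.

(* Both divisions by 4 are exact when L and all components of m are even. *)
Definition mexp (cs : seq nat) (L : nat) (m : 'cV[int]_(rank cs)) : int :=
  (((m^T *m Cmx cs *m m) 0 0)%R %/ 4)%Z - (L%:Z ^+ 2 %/ 4)%Z.

(* The division by 2 is exact when all components of m are even. *)
Definition mprod (cs : seq nat) (m : 'cV[int]_(rank cs)) : Kq :=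
  \prod_(j < rank cs | (1 <= j)%N)
     gauss (m j 0 - (((Cmx cs *m m) j 0)%R %/ 2)%Z) (m j 0).

Definition is_smallest_rs (p p' r0 s0 : nat) : Prop :=
  let sol (r s : nat) := `|p%:Z * s%:Z - p'%:Z * r%:Z| = 1 in
  sol r0 s0 /\ forall r s : nat, sol r s -> (r0 <= r)%N /\ (s0 <= s)%N.

(* Main.v *)
(**
Call a vertex up-facing or down-facing according to the step that leaves it.
Grouping the paths from a fixed height [a] by length, end point, facing, number
[u] of up-steps and number [s] of scoring vertices gives functions [pgf]
satisfying a two-term recursion on the last step.  The recursion depends only
on whether the facing is "like" an even up-step or an even down-step, and it
admits two transformations (Foda-Welsh):
- duality [(p, p') -> (p' - p, p')] exchanges even and odd bands, hence scoring
  and non-scoring vertices, and replaces [q] by [1/q] up to a power of [q];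
- the Burge transform [(p, p') -> (p, p' + p)] inserts one even band between
  consecutive odd ones; on [pgf] it acts as a q-binomial convolution in [s],
  which follows from the recursion and the q-Pascal rule.
The continued fraction of [p'/p] tells how to reach [(p, p')] from [(1, 2)] by
these two moves.  Starting at [a = s_0], next to an odd band, is preserved by
both.  The fermionic sum, peeled off one summation variable at a time, obeys the
same recursion: each Burge transform adds a row of [C], and each duality turns
the first row into a "turn" row.
*)
Require Import Defs.
From mathcomp Require Import all_boot all_order all_algebra.
From mathcomp Require Import zify ring.
From mathcomp Require Import boolp classical_sets fsbigop.
Set Implicit Arguments.
Unset Strict Implicit.
Unset Printing Implicit Defensive.
Import Order.TTheory GRing.Theory Num.Theory.
Local Open Scope ring_scope.


(** * Gaussian polynomials and q-convolutions *)

(* Duality needs [q^-1] as well as [q], hence an arbitrary point of a field. *)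
Definition generic (K : fieldType) (v : K) : Prop :=
  v != 0 /\ forall n, (0 < n)%N -> v ^+ n != 1.

Lemma generic_inv (K : fieldType) (v : K) : generic v -> generic v^-1.
Proof.
case=> v0 v1; split=> [|n n0]; first by rewrite invr_eq0.
by rewrite exprVn -[1]invr1 (inj_eq invr_inj) v1.
Qed.

Section QBinomial.
Variables (K : fieldType) (v : K).

Definition qfact (n : nat) : K := \prod_(1 <= i < n.+1) (1 - v ^+ i).

(* The Gaussian polynomial [l + n choose l]. *)
Definition qbin (l n : nat) : K := qfact (l + n) / (qfact l * qfact n).

Lemma qfact0 : qfact 0 = 1.
Proof. by rewrite /qfact big_geq. Qed.

Lemma qfactS n : qfact n.+1 = qfact n * (1 - v ^+ n.+1).
Proof. by rewrite /qfact big_nat_recr. Qed.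

Hypothesis v_gen : generic v.

Lemma qfact_neq0 n : qfact n != 0.
Proof.
elim: n => [|n IH]; first by rewrite qfact0 oner_neq0.
by rewrite qfactS mulf_neq0 // subr_eq0 eq_sym; apply: v_gen.2.
Qed.

Lemma qbin0r l : qbin l 0 = 1.
Proof. by rewrite /qbin addn0 qfact0 mulr1 divff // qfact_neq0. Qed.

Lemma qbin0l n : qbin 0 n = 1.
Proof. by rewrite /qbin add0n qfact0 mul1r divff // qfact_neq0. Qed.

Lemma qbin_pascal l n :
  qbin l.+1 n.+1 = qbin l n.+1 + v ^+ l.+1 * qbin l.+1 n.
Proof.
rewrite /qbin !addnS !addSn !qfactS.
have := qfact_neq0 l.+1; have := qfact_neq0 n.+1; rewrite !qfactS.
rewrite !mulf_eq0 !negb_or => /andP[n0 n1] /andP[l0 l1].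
move: n1 l1.
set y := v ^+ l.+1; set z := v ^+ n.+1 => n1 l1.
have -> : v ^+ (l + n).+2 = y * z by rewrite -exprD addSn addnS.
field.
by rewrite n0 n1 l0 l1.
Qed.

Lemma qbinC l n : qbin l n = qbin n l.
Proof. by rewrite /qbin addnC [_ * qfact n]mulrC. Qed.

End QBinomial.

(** The Gaussian polynomial is palindromic of degree [l * n]. In the induction, the Pascal rule at
    [v^-1] meets the mirrored rule at [v], obtained through [qbinC]. *)
Lemma qbin_inv (K : fieldType) (v : K) (l n : nat) : generic v ->
  qbin v^-1 l n = (v ^+ (l * n))^-1 * qbin v l n.
Proof.
move=> gv; have gi := generic_inv gv; have v0 := gv.1.
elim: l n => [|l IHl] n; first by rewrite !qbin0l // mul0n invr1 mulr1.
elim: n => [|n IHn]; first by rewrite !qbin0r // muln0 invr1 mulr1.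
rewrite qbin_pascal // IHl IHn [qbin v l.+1 n.+1]qbinC qbin_pascal //.
rewrite [qbin v n l.+1]qbinC [qbin v n.+1 l]qbinC exprVn.
have -> : (l.+1 * n.+1 = l * n.+1 + n.+1)%N by lia.
have -> : (v ^+ (l.+1 * n)) = v ^+ (l * n.+1) * v ^+ n / v ^+ l.
  apply: (mulIf (expf_neq0 l v0)); rewrite mulfVK ?expf_neq0 // -!exprD.
  by congr (v ^+ _); lia.
rewrite exprD !exprS.
have := expf_neq0 l v0; have := expf_neq0 n v0; have := expf_neq0 (l * n.+1) v0.
by move=> h1 h2 h3; field; rewrite v0 h1 h2 h3.
Qed.

(** * Sequences indexed by the number of scoring vertices, and their q-binomial convolution *)

Section Delay.
Variables (K : fieldType) (v : K).
Implicit Type f g : nat -> K.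

(** Coefficients after multiplication by [z ^ k], where [z] marks the index [s]. *)
Definition delay (k : nat) f (s : nat) : K := if (k <= s)%N then f (s - k)%N else 0.

Lemma delay_small k f s : (s < k)%N -> delay k f s = 0.
Proof. by rewrite /delay ltnNge => /negbTE->. Qed.

Lemma delay0 f s : delay 0 f s = f s.
Proof. by rewrite /delay subn0. Qed.

Lemma delayS k f s : delay k.+1 f s.+1 = delay k f s.
Proof. by rewrite /delay ltnS subSS. Qed.

Lemma delayD j k f s : delay j (delay k f) s = delay (j + k) f s.
Proof.
rewrite /delay; have -> : (j + k <= s)%N = (j <= s)%N && (k <= s - j)%N by lia.
by case: (j <= s)%N; case: (k <= s - j)%N; rewrite //= subnDA.
Qed.

Lemma eq_delay k f g s : f =1 g -> delay k f s = delay k g s.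
Proof. by move=> fg; rewrite /delay fg. Qed.

Lemma delay_add k f g s :
  delay k (fun t => f t + g t) s = delay k f s + delay k g s.
Proof. by rewrite /delay; case: ifP; rewrite ?addr0. Qed.

Lemma delay_scale k c f s : delay k (fun t => c * f t) s = c * delay k f s.
Proof. by rewrite /delay; case: ifP; rewrite ?mulr0. Qed.

(** Multiplication of the series of [f] by the sum of [qbin v l n * z ^ (2n)], which for generic [v]
    is the inverse of the product of [1 - v ^ j * z ^ 2] over [0 <= j <= l]. *)
Definition qconv (l : nat) f (s : nat) : K :=
  \sum_(n < s.+1) qbin v l n * delay n.*2 f s.

Lemma qconv_widen l f s M : (s < M.*2)%N ->
  qconv l f s = \sum_(n < M) qbin v l n * delay n.*2 f s.
Proof.
pose F n := qbin v l n * delay n.*2 f s.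
have F0 n : (s < n.*2)%N -> F n = 0.
  by move=> h; rewrite /F delay_small // mulr0.
have wid A B : (A <= B)%N -> (s < A.*2)%N ->
    \sum_(n < A) F n = \sum_(n < B) F n.
  move=> AB h; rewrite -!(big_mkord xpredT F) (big_cat_nat (n := A) _ AB) //=.
  rewrite [X in _ + X]big_nat_cond [X in _ + X]big1 ?addr0 // => i hi.
  by apply: F0; lia.
move=> hM; rewrite /qconv; case: (leqP s.+1 M) => h; first by apply: wid; lia.
by apply/esym/wid; lia.
Qed.

Lemma eq_qconv l f g s : f =1 g -> qconv l f s = qconv l g s.
Proof. by move=> fg; apply: eq_bigr => n _; rewrite (eq_delay _ _ fg). Qed.

Lemma qconvD l f g s :
  qconv l (fun t => f t + g t) s = qconv l f s + qconv l g s.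
Proof. by rewrite /qconv -big_split /=; apply: eq_bigr => n _; rewrite delay_add mulrDr. Qed.

Lemma qconvZ l c f s : qconv l (fun t => c * f t) s = c * qconv l f s.
Proof. by rewrite /qconv mulr_sumr; apply: eq_bigr => n _; rewrite delay_scale mulrCA. Qed.

Lemma qconv_delay l f s : qconv l (delay 1 f) s = delay 1 (qconv l f) s.
Proof.
case: s => [|s]; first by rewrite /qconv big_ord1 delayD delay_small ?mulr0.
rewrite delayS delay0 (@qconv_widen _ _ _ s.+1); last by lia.
by apply: eq_bigr => n _; rewrite delayD addn1 delayS.
Qed.

Hypothesis v_gen : generic v.

(** Passing from [l] to [l.+1] divides the series by one more factor, [1 - v ^ (l.+1) * z ^ 2]; on
    coefficients this is the q-Pascal rule. *)
Lemma qconv_pascal l f s :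
  qconv l.+1 f s = qconv l f s + v ^+ l.+1 * delay 2 (qconv l.+1 f) s.
Proof.
rewrite (@qconv_widen _ _ _ s.+2); last lia.
rewrite (@qconv_widen l _ _ s.+2); last lia.
rewrite !(big_ord_recl s.+1) !qbin0r // -addrA; congr (_ + _).
under eq_bigr => n _ do rewrite lift0 qbin_pascal // mulrDl.
rewrite big_split /=; congr (_ + _).
case: s => [|[|s]].
- by rewrite big_ord1 !delay_small ?mulr0.
- by rewrite 2!big_ord_recl big_ord0 !delay_small ?mulr0 ?addr0.
rewrite !delayS delay0 (@qconv_widen _ _ _ s.+3); last lia.
rewrite mulr_sumr; apply: eq_bigr => n _.
by rewrite doubleS !delayS mulrA.
Qed.

Lemma qconv0 f s : qconv 0 f s = f s + delay 2 (qconv 0 f) s.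
Proof.
rewrite (@qconv_widen _ _ _ s.+2); last lia.
rewrite (big_ord_recl s.+1) qbin0r // mul1r delay0; congr (_ + _).
case: s => [|[|s]].
- by rewrite big_ord1 !delay_small ?mulr0.
- by rewrite 2!big_ord_recl big_ord0 !delay_small ?mulr0 ?addr0.
rewrite !delayS delay0 (@qconv_widen _ _ _ s.+3); last lia.
by apply: eq_bigr => n _; rewrite !qbin0l // doubleS !delayS.
Qed.

(** The argument [f + c * delay 1 g] has the shape of the recursion of [pgf] on the last step. *)
Lemma qconv_step l f g c s :
  qconv l.+1 (fun t => f t + c * delay 1 g t) s =
  qconv l f s + v ^+ l.+1 * delay 2 (qconv l.+1 f) s
  + c * delay 1 (qconv l.+1 g) s.
Proof. by rewrite qconvD qconvZ qconv_delay -qconv_pascal. Qed.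

End Delay.

(** * Odd bands under the two transformations *)

Lemma divn_uniq (m d r : nat) : (r * d <= m)%N -> (m < r.+1 * d)%N -> (m %/ d)%N = r.
Proof.
move=> h1 h2; have d0 : (0 < d)%N by case: d h2 {h1} => //; rewrite muln0.
by apply/eqP; rewrite eqn_leq -ltnS ltn_divLR // h2 leq_divRL.
Qed.

Section Bands.
Variables (p p' : nat).
Hypotheses (p_gt0 : (0 < p)%N) (p_lt : (p < p')%N).

(** The number of odd bands below height [b]: by [odd_below_next] this floor jumps exactly across
    them. *)
Definition odd_below (b : nat) : nat := (b * p %/ p')%N.

Lemma odd_below_bounds b : (odd_below b * p' <= b * p)%N /\ (b * p < (odd_below b).+1 * p')%N.
Proof.
split; first exact: leq_divM.
by rewrite ltn_ceil //; lia.
Qed.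

Lemma odd_below_next b :
  odd_below b.+1 = (odd_below b + ~~ even_band p p' b)%N.
Proof.
rewrite /even_band -/(odd_below b) -/(odd_below b.+1).
have [h1 h2] := odd_below_bounds b; have [h3 h4] := odd_below_bounds b.+1.
move: h1 h2 h3 h4; set r := odd_below b; set r1 := odd_below b.+1 => h1 h2 h3 h4.
have : (r <= r1)%N by rewrite leq_div2r // leq_pmul2r.
have : (r1 <= r.+1)%N.
  rewrite -ltnS -(@ltn_pmul2r p'); last by lia.
  apply: leq_ltn_trans h3 _; rewrite mulSn addnC mulSn; lia.
by case: eqVneq => /=; lia.
Qed.

Lemma odd_below_lt b : (b < p')%N -> (odd_below b < p)%N.
Proof. by move=> h; rewrite ltn_divLR ?ltn_pmul2l 1?mulnC ?ltn_pmul2l //; lia. Qed.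

Lemma odd_below1 : odd_below 1 = 0%N.
Proof. by rewrite /odd_below mul1n divn_small. Qed.

Lemma odd_below_top b : b.+1 = p' -> odd_below b = p.-1.
Proof. move=> h; apply: divn_uniq; rewrite -h ?(ltn_predK p_gt0); nia. Qed.

Lemma leq_odd_below b c : (b <= c)%N -> (odd_below b <= odd_below c)%N.
Proof. by move=> h; rewrite leq_div2r // leq_mul2r h orbT. Qed.

End Bands.

(** Write [f b] for [odd_below p p' b]. Height [b] is stretched to an even band of [(p, p' + p)],
    from [b + f b] to [b + f b + 1], and [x] picks one of its ends. The bands of successive heights
    meet if the old band between the heights is even; otherwise one odd band separates them. *)
Lemma odd_below_shift (p p' b : nat) (x : bool) : (0 < p)%N -> (p < p')%N ->
  odd_below p (p' + p) (b + odd_below p p' b + x) = odd_below p p' b.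
Proof.
move=> p0 pp; have [] := odd_below_bounds p0 pp b.
by set r := odd_below _ _ b => h1 h2; apply: divn_uniq; case: x => /=; nia.
Qed.

Lemma even_band_shift (p p' b : nat) : (0 < p)%N -> (p < p')%N ->
  even_band p (p' + p) (b + odd_below p p' b).
Proof.
move=> p0 pp; rewrite /even_band -/(odd_below p (p' + p) _) -/(odd_below p (p' + p) _.+1).
have := @odd_below_shift p p' b false p0 pp; rewrite addn0 => ->.
by have := @odd_below_shift p p' b true p0 pp; rewrite addn1 => ->.
Qed.

Lemma even_band_shift_next (p p' b : nat) : (0 < p)%N -> (p < p')%N ->
  even_band p (p' + p) (b + odd_below p p' b).+1 = even_band p p' b.
Proof.
move=> p0 pp; rewrite /even_band -/(odd_below p (p' + p) _) -/(odd_below p (p' + p) _.+1).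
have := @odd_below_shift p p' b true p0 pp; rewrite addn1 => ->.
rewrite -/(odd_below p p' b) -/(odd_below p p' b.+1).
have h := odd_below_next p0 pp b.
have hT := @odd_below_shift p p' b.+1 true p0 pp.
have hF := @odd_below_shift p p' b.+1 false p0 pp.
case E : (even_band p p' b) h => /= h.
- have -> : (b + odd_below p p' b).+2 = (b.+1 + odd_below p p' b.+1 + 1)%N by lia.
  by rewrite hT.
- have -> : (b + odd_below p p' b).+2 = (b.+1 + odd_below p p' b.+1 + 0)%N by lia.
  by rewrite hF.
Qed.

(** By coprimality [b * p / p'] is not an integer for [0 < b < p'], so the two floors add up to
    [b - 1]. Hence exactly one of them jumps across each band. *)
Lemma even_band_dual (p p' b : nat) : coprime p p' -> (p < p')%N ->
  (0 < b)%N -> (b.+1 < p')%N ->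
  even_band (p' - p) p' b = ~~ even_band p p' b.
Proof.
move=> cop pp b0 bp.
have p0 : (0 < p)%N by case: p cop pp => // ; rewrite /coprime gcd0n; lia.
have q0 : (0 < p' - p)%N by lia.
have qp : (p' - p < p')%N by lia.
have dual c : (0 < c)%N -> (c < p')%N -> (odd_below (p' - p) p' c + odd_below p p' c).+1 = c.
  move=> c0 cp; have [h1 h2] := odd_below_bounds p0 pp c.
  have h3 : (odd_below p p' c * p' != c * p)%N.
    apply/eqP => e; have : (p' %| c * p)%N by rewrite -e dvdn_mull.
    by rewrite Gauss_dvdl 1?coprime_sym // => /dvdn_leq; lia.
  suff -> : odd_below (p' - p) p' c = (c - (odd_below p p' c).+1)%N.
    have := odd_below_lt p0 pp cp; nia.
  by apply: divn_uniq; nia.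
have := dual b b0 ltac:(lia); have := dual b.+1 ltac:(lia) bp.
rewrite (odd_below_next p0 pp) (odd_below_next q0 qp).
by case: even_band; case: even_band => //=; lia.
Qed.

(** * Path generating functions *)

Section PathFunction.
Variables (K : fieldType) (v : K) (p p' a : nat) (ty : bool).

(* [x] is true for "facing an even band above or an odd band below", the two
   facings that share one recursion, and false for the two others.  The number
   [u] of up-steps is a free parameter: the value is 0 unless [b = a + 2u - L].
   [ty] tells whether the odd band next to [a] is the one below.  At [L = 0] the
   value [x = ty] is the empty path; the other one, 1 at [s = 1], belongs to no
   path: it is the empty path as if it came through that odd band, and it makes
   the Burge transform valid from length 0 on. *)
Fixpoint pgf (L : nat) (x : bool) (b : nat) (u : int) (s : nat) : K :=
  if L is L1.+1 then
    let P t := if (1 < b)%N then pgf L1 (even_band p p' b.-1) b.-1 (u - 1) t else 0 in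
    let Q t := if (b.+1 < p')%N then pgf L1 (~~ even_band p p' b) b.+1 u t else 0 in
    if x then P s + v ^ u * delay 1 Q s
    else v ^ (L%:Z - u) * delay 1 P s + Q s
  else ((b == a) && (u == 0) && (s == x (+) ty :> nat))%:R.

Definition from_below L b u s : K :=
  if (1 < b)%N then pgf L (even_band p p' b.-1) b.-1 (u - 1) s else 0.
Definition from_above L b u s : K :=
  if (b.+1 < p')%N then pgf L (~~ even_band p p' b) b.+1 u s else 0.

Lemma pgf0 x b u s :
  pgf 0 x b u s = ((b == a) && (u == 0) && (s == x (+) ty :> nat))%:R.
Proof. by []. Qed.

(** For [x] true, a vertex scores exactly when a down-step enters it, with weight its y-coordinate
    [u]. For [x] false it scores exactly when an up-step enters it, with weight its x-coordinate,
    the length minus [u]. *)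
Lemma pgfS_true L b u s :
  pgf L.+1 true b u s = from_below L b u s + v ^ u * delay 1 (from_above L b u) s.
Proof. by []. Qed.

Lemma pgfS_false L b u s :
  pgf L.+1 false b u s =
  v ^ (L.+1%:Z - u) * delay 1 (from_below L b u) s + from_above L b u s.
Proof. by []. Qed.

(* The fictitious initial value is never reached by an actual path. *)
Definition start_ok :=
  ((a.+1 < p')%N -> even_band p p' a = ty) /\
  ((1 < a)%N -> even_band p p' a.-1 = ~~ ty).

(** A path cannot score more often than it has steps. The fictitious initial value has [s = 1] at
    length 0, but by [start_ok] no step continues it. *)
Lemma from_overflow L : start_ok -> forall b u s, (0 < b < p')%N -> (L < s)%N ->
  from_below L b u s = 0 /\ from_above L b u s = 0.
Proof.
case=> h1 h2; elim: L => [|L IH] b u s hb Ls.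
- rewrite /from_below /from_above !pgf0; split; case: ifP => // hb'.
  + case: eqVneq => //= ea; rewrite ea h1; last by lia.
    by rewrite addbb eqn0Ngt Ls andbF.
  + case: eqVneq => //= ea; rewrite -[b]/(b.+1.-1) ea h2; last by lia.
    by rewrite negbK addbb eqn0Ngt Ls andbF.
have pgf_0 x c w : (0 < c < p')%N -> pgf L.+1 x c w s = 0.
  move=> hc; have [PA QA] := IH c w s hc (ltnW Ls).
  have [PB QB] := IH c w s.-1 hc ltac:(lia).
  have -> : s = s.-1.+1 by lia.
  case: x; rewrite ?pgfS_true ?pgfS_false delayS delay0 ?PB ?QB ?mulr0 ?addr0 ?add0r.
    by rewrite prednK ?PA //; lia.
  by rewrite prednK ?QA //; lia.
by split; rewrite /from_below /from_above; case: ifP => // hb'; apply: pgf_0; lia.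
Qed.

End PathFunction.
Arguments pgf : simpl never.

(** * The Burge transform and duality *)

Section Burge.
Variables (K : fieldType) (v : K) (p p' a : nat) (ty : bool).
Hypotheses (v_gen : generic v) (p_gt0 : (0 < p)%N) (p_lt : (p < p')%N).
Let f := odd_below p p'.
Let r0 := (f a + ~~ ty)%N.
Let st := pgf v p p' a ty.
Let st' := pgf v p (p' + p) (a + r0) ty.
Hypothesis start' : start_ok p (p' + p) (a + r0) ty.

(* [i] and [s - i] are the numbers of up- and down-steps that are added. *)
Definition burge_claim L := forall x b l s (u i : int), (L = l + s)%N ->
  (0 < b < p')%N -> (f b + ~~ x)%:Z - r0%:Z = i + i - s%:Z ->
  st' L x (b + f b + ~~ x) (u + i) s = v ^ (i * (s%:Z - i)) * qconv v l (st l x b u) s.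

Lemma qconv_0 l g s : g =1 (fun _ => 0) -> qconv v l g s = 0.
Proof.
move=> g0; rewrite /qconv big1 // => n _.
by rewrite (eq_delay _ _ g0) /delay; case: ifP; rewrite mulr0.
Qed.

(** A step from below into the lower end of the band inserted at [b] lifts the old step into [b]: it
    comes from that end of the band inserted at [b.-1] which has the same flag [x]. *)
Lemma burge_below L l s b (u i : int) : burge_claim L -> (L = l + s)%N ->
  (0 < b < p')%N -> (f b)%:Z - r0%:Z = i + i - s%:Z ->
  from_below v p (p' + p) (a + r0) ty L (b + f b) (u + i) s =
  v ^ (i * (s%:Z - i)) * qconv v l (from_below v p p' a ty l b u) s.
Proof.
move=> IH eL hb hi; rewrite /from_below.
case: (ltnP 1 b) => b1; last first.
  have -> : b = 1%N by lia.
  by rewrite /f odd_below1 //= qconv_0 ?mulr0.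
have -> : (1 < b + f b)%N by lia.
have [c eb] : exists c, b = c.+1 by exists b.-1; lia.
have fS := odd_below_next p_gt0 p_lt c; rewrite -/(f c) -/(f c.+1) in fS.
rewrite addrAC; subst b; rewrite /= -/(f c.+1).
have key : (c + f c.+1)%N = (c + f c + ~~ even_band p p' c)%N by rewrite fS addnA.
have -> : even_band p (p' + p) (c + f c.+1) = even_band p p' c.
  rewrite key; case E : (even_band p p' c); first by rewrite addn0 even_band_shift.
  by rewrite addn1 even_band_shift_next.
by rewrite key; apply: IH => //; lia.
Qed.

Lemma burge_above L l s b (u i : int) : burge_claim L -> (L = l + s)%N ->
  (0 < b < p')%N -> (f b).+1%:Z - r0%:Z = i + i - s%:Z ->
  from_above v p (p' + p) (a + r0) ty L (b + f b).+1 (u + i) s =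
  v ^ (i * (s%:Z - i)) * qconv v l (from_above v p p' a ty l b u) s.
Proof.
move=> IH eL hb hi; rewrite /from_above.
have fp : (f b < p)%N by apply: odd_below_lt; lia.
have fS := odd_below_next p_gt0 p_lt b; rewrite -/(f b) -/(f b.+1) in fS.
case: (ltnP b.+1 p') => bp; last first.
  have fE : f b = p.-1 by apply: odd_below_top => //; lia.
  by rewrite ifF ?qconv_0 ?mulr0 //; lia.
have -> : ((b + f b).+2 < p' + p)%N by lia.
rewrite even_band_shift_next //.
have -> : (b + f b).+2 = (b.+1 + f b.+1 + ~~ ~~ even_band p p' b)%N.
  by rewrite fS; case: even_band => /=; lia.
by apply: IH => //; rewrite fS; case: even_band hi => /=; lia.
Qed.

(** The other last steps cross the inserted even band itself: they stay over the same old height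
    [b], switch the flag, and are added steps. *)
Lemma above_lower L b u s : (0 < b < p')%N ->
  from_above v p (p' + p) (a + r0) ty L (b + f b) u s = st' L false (b + f b).+1 u s.
Proof.
move=> hb; have fp : (f b < p)%N by apply: odd_below_lt; lia.
by rewrite /from_above ifT ?even_band_shift //; lia.
Qed.

Lemma below_upper L b u s : (0 < b < p')%N ->
  from_below v p (p' + p) (a + r0) ty L (b + f b).+1 u s = st' L true (b + f b) (u - 1) s.
Proof. by move=> hb; rewrite /from_below ifT ?even_band_shift //=; lia. Qed.

(** For [l = 0] the series is multiplied by [1 / (1 - z ^ 2)], so only the parity of the index
    matters. *)
Lemma qconv0_flip (e c : bool) t :
  qconv v 0 (fun s => (c && (s == e :> nat))%:R) t.+1 =
  qconv v 0 (fun s => (c && (s == ~~ e :> nat))%:R) t.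
Proof.
have shift s : (c && (s == 1%N))%:R = delay 1 (fun s => (c && (s == 0%N))%:R : K) s.
  by case: s => [|s]; [rewrite delay_small ?andbF | rewrite delayS delay0].
case: e => /=.
  by rewrite (eq_qconv _ _ _ shift) qconv_delay delayS delay0.
by rewrite (eq_qconv _ _ t shift) qconv_delay qconv0 // andbF add0r delayS.
Qed.

Lemma burge_claim_all L : burge_claim L.
Proof.
have v0 := v_gen.1.
elim: L => [|L IH] x b l s u i eL hb hi.
  have [-> ->] : l = 0%N /\ s = 0%N by lia.
  rewrite /qconv big_ord1 delay0 qbin0r // mul1r /st /st' !pgf0.
  case: (eqVneq x ty) => [ex|nx]; last first.
    have -> : (0%N == x (+) ty :> nat) = false by case: x ty nx {hi} => [] [].
    by rewrite !andbF mulr0.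
  have fm c d : (c <= d)%N -> (f c <= f d)%N by apply: leq_odd_below.
  (* [b + f b] is strictly increasing in [b], and both ends carry the same flag. *)
  have -> : (b + f b + ~~ x == a + r0)%N = (b == a).
    rewrite /r0 ex; have := fm a b; have := fm b a.
    by case: (ltngtP a b) => [h|h|->] ha hb'; apply/eqP; lia.
  case: (eqVneq b a) => [eb|]; last by rewrite mulr0.
  have -> : i = 0 by move: hi; rewrite eb ex /r0; lia.
  by rewrite mul0r expr0z mul1r addr0.
(* If [l = 0], every vertex scores, and the lifted path only runs back and forth across the even
   band inserted at [a]. *)
case: l eL => [|l] eL.
  case: s hi eL => [|s] hi eL; first by lia.
  have eL0 : L = (0 + s)%N by lia.
  have fp : (f b < p)%N by apply: odd_below_lt; lia.
  have flip : qconv v 0 (st 0 x b u) s.+1 = qconv v 0 (st 0 (~~ x) b u) s.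
    rewrite /st (eq_qconv _ _ _ (pgf0 _ _ _ _ _ _ _ _)) qconv0_flip.
    by apply: eq_qconv => t; rewrite pgf0 addNb.
  have u_eq0 e : v ^ e * qconv v 0 (st 0 (~~ x) b u) s =
      v ^ (e + u) * qconv v 0 (st 0 (~~ x) b u) s.
    case: (eqVneq u 0) => [->|un]; first by rewrite addr0.
    by rewrite qconv_0 ?mulr0 // => t; rewrite /st pgf0 (negbTE un) andbF.
  rewrite flip; case: x hi {flip} u_eq0 => /= hi u_eq0.
  + rewrite addn0 /st' pgfS_true delayS delay0.
    have [|-> _] := @from_overflow _ v _ _ _ _ L start' (b + f b) (u + i) s.+1 _ ltac:(lia).
      by lia.
    rewrite add0r above_lower // -addn1 (IH false b 0%N s) //=; last by lia.
    rewrite mulrA -expfzDr // [RHS]u_eq0; congr (v ^ _ * _); lia.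
  + rewrite addn1 /st' pgfS_false delayS delay0.
    have [|_ ->] := @from_overflow _ v _ _ _ _ L start' (b + f b).+1 (u + i) s.+1 _ ltac:(lia).
      by lia.
    have IHx : (f b + ~~ true)%:Z - r0%:Z = (i - 1) + (i - 1) - s%:Z by move: hi => /=; lia.
    have := IH true b 0%N s u (i - 1) eL0 hb IHx; rewrite addn0 addrA => IHe.
    rewrite addr0 below_upper // IHe.
    rewrite mulrA -expfzDr // [LHS]u_eq0; congr (v ^ _ * _); lia.
have fp : (f b < p)%N by apply: odd_below_lt; lia.
have eL1 : L = (l + s)%N by lia.
set P := from_below v p p' a ty l b u; set Q := from_above v p p' a ty l b u.
have stT : st l.+1 true b u =1 fun t => P t + v ^ u * delay 1 Q t by [].
have stF : st l.+1 false b u =1 fun t => Q t + v ^ (l.+1%:Z - u) * delay 1 P t.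
  by move=> t; rewrite /st pgfS_false addrC.
(* One scoring vertex fewer at the same length [L] means [l.+1] in place of [l]. *)
have IHs t y (j : int) : s = t.+1 -> (f b + ~~ y)%:Z - r0%:Z = j + j - t%:Z ->
    st' L y (b + f b + ~~ y) (u + j) t = v ^ (j * (t%:Z - j)) * qconv v l.+1 (st l.+1 y b u) t.
  by move=> est hj; apply: IH => //; lia.
case: x hi => /= hi.
- rewrite addn0 /st' pgfS_true (burge_below _ IH eL1) //; last by lia.
  rewrite (eq_qconv _ _ _ stT) qconv_step //.
  case: s hi eL eL1 IHs => [|s] hi eL eL1 IHs; first by rewrite !delay_small // !mulr0 !addr0.
  have IHx : (f b + ~~ false)%:Z - r0%:Z = i + i - s%:Z by move: hi => /=; lia.
  (* The crossing step comes from the other flag over [b]; expanding its value by [stF] gives the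
     last two terms of [qconv_step]. *)
  rewrite !delayS !delay0 above_lower //.
  have := IHs s false i erefl IHx; rewrite addn1 => ->.
  rewrite (eq_qconv _ _ _ stF) qconvD qconvZ qconv_delay !mulrDr -!addrA; congr (_ + _).
  rewrite addrC; congr (_ + _); rewrite !mulrA -!expfzDr // ?exprnP -?expfzDr //.
    by congr (v ^ _ * _); lia.
  by congr (v ^ _ * _); lia.
- rewrite addn1 /st' pgfS_false (burge_above _ IH eL1) //; last by lia.
  rewrite (eq_qconv _ _ _ stF) qconv_step //.
  case: s hi eL eL1 IHs => [|s] hi eL eL1 IHs; first by rewrite !delay_small // !mulr0 !addr0 add0r.
  have IHx : (f b + ~~ true)%:Z - r0%:Z = (i - 1) + (i - 1) - s%:Z by move: hi => /=; lia.
  rewrite !delayS !delay0 below_upper //.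
  have := IHs s true (i - 1) erefl IHx; rewrite addn0 addrA => ->.
  rewrite (eq_qconv _ _ _ stT) qconvD qconvZ qconv_delay !mulrDr.
  rewrite [LHS]addrC -!addrA; congr (_ + _).
  rewrite addrC; congr (_ + _); rewrite !mulrA -!expfzDr // ?exprnP -?expfzDr //.
    by congr (v ^ _ * _); lia.
  by congr (v ^ _ * _); lia.
Qed.

Lemma burge x b l s (u i : int) : (0 < b < p')%N ->
  (f b + ~~ x)%:Z - r0%:Z = i + i - s%:Z ->
  st' (l + s) x (b + f b + ~~ x) (u + i) s =
  v ^ (i * (s%:Z - i)) * qconv v l (st l x b u) s.
Proof. exact: burge_claim_all. Qed.
End Burge.

(** Each vertex scores in exactly one of the two models, with the same weight. Summed over all
    vertices, these weights count the pairs of an up-step and a down-step, hence the total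
    [u * (L - u)]. *)
Lemma pgf_dual (K : fieldType) (v : K) (p p' a : nat) (ty : bool) L x b (u : int) s :
  v != 0 -> coprime p p' -> (p < p')%N -> 
  start_ok p p' a ty -> start_ok (p' - p) p' a (~~ ty) ->
  (0 < b < p')%N -> (s <= L)%N ->
  pgf v (p' - p) p' a (~~ ty) L x b u s =
  v ^ (u * (L%:Z - u)) * pgf v^-1 p p' a ty L (~~ x) b u (L - s).
Proof.
move=> v0 cop pp ok ok'.
elim: L x b u s => [|L IH] x b u s hb sL.
  have -> : s = 0%N by lia.
  rewrite !pgf0 subn0 addbN addNb.
  case: (eqVneq u 0) => [->|]; first by rewrite mul0r expr0z mul1r.
  by rewrite !andbF mulr0.
have below t : (t <= L)%N -> from_below v (p' - p) p' a (~~ ty) L b u t =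
    v ^ ((u - 1) * (L%:Z - (u - 1))) * from_below v^-1 p p' a ty L b u (L - t).
  move=> tL; rewrite /from_below; case: ifP => hb'; last by rewrite mulr0.
  rewrite even_band_dual ?IH ?negbK //; lia.
have above t : (t <= L)%N -> from_above v (p' - p) p' a (~~ ty) L b u t =
    v ^ (u * (L%:Z - u)) * from_above v^-1 p p' a ty L b u (L - t).
  move=> tL; rewrite /from_above; case: ifP => hb'; last by rewrite mulr0.
  rewrite even_band_dual ?IH ?negbK //; lia.
have [oP oQ] := from_overflow v^-1 ok u hb (ltnSn L).
have [|oP' oQ'] := @from_overflow _ v _ _ _ _ L ok' b u L.+1 hb; first by [].
(* A delayed branch on one side faces an undelayed one on the other; the extreme values of [s] match
   by [from_overflow]. *)
have dE (F G : nat -> K) c : (forall t, (t <= L)%N -> F t = c * G (L - t)%N) -> G L.+1 = 0 ->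
    delay 1 F s = c * G (L.+1 - s)%N.
  move=> FG GL; case: s sL => [|s] sL; first by rewrite delay_small // subn0 GL mulr0.
  by rewrite delayS delay0 FG.
have nE (F G : nat -> K) c : (forall t, (t <= L)%N -> F t = c * G (L - t)%N) -> F L.+1 = 0 ->
    F s = c * delay 1 G (L.+1 - s).
  move=> FG FL; case: (ltngtP s L.+1) sL => // [sL|->] _; last by rewrite subnn delay_small // mulr0.
  by rewrite subSn // delayS delay0 FG.
have eV (e e' : int) (y : K) : e = e' -> v ^ e * y = v ^ e' * y by move=> ->.
case: x; rewrite /= ?pgfS_true ?pgfS_false.
- rewrite (nE _ _ _ below oP') (dE _ _ _ above oQ) [RHS]mulrDr !mulrA !exprz_inv -!expfzDr //.
  by congr (_ + _); apply: eV; lia.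
- rewrite (dE _ _ _ below oP) (nE _ _ _ above oQ') [RHS]mulrDr !mulrA !exprz_inv -!expfzDr //.
  by congr (_ + _); apply: eV; lia.
Qed.

(** * Closed paths of even length *)

Section HalfLength.
Variables (K : fieldType) (v : K).

(* Closed paths of length [2 lam] with [2 sig] scoring vertices. *)
Definition half_pgf (p p' a : nat) (ty : bool) (lam sig : nat) : K :=
  pgf v p p' a ty lam.*2 ty a lam%:Z sig.*2.

(** The level [odd_below p p' b + ~~ x] of the last vertex changes by one at each scoring vertex and
    is kept at the others. *)
Lemma pgf_parity p p' a ty L x b u s : (0 < p)%N -> (p < p')%N ->
  odd s != odd (odd_below p p' b + ~~ x + (odd_below p p' a + ~~ ty)) ->
  pgf v p p' a ty L x b u s = 0.
Proof.
move=> p0 pp; elim: L x b u s => [|L IH] x b u s h.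
  rewrite pgf0; case: (eqVneq b a) h => [->|_ _] //= h; case: (u == 0) => //=.
  case: eqVneq => //= es; case/negP: h; rewrite es !oddD; apply/eqP.
  by case: (odd (odd_below _ _ _)) x ty {es} => [] [] [].
have below t : odd t != odd (odd_below p p' b + (odd_below p p' a + ~~ ty)) ->
    from_below v p p' a ty L b u t = 0.
  rewrite /from_below; case: ifP => // b1 ht; apply: IH; apply: contra ht => /eqP->.
  by move: (odd_below_next p0 pp b.-1); rewrite (ltn_predK b1) => ->.
have above t : odd t != odd ((odd_below p p' b).+1 + (odd_below p p' a + ~~ ty)) ->
    from_above v p p' a ty L b u t = 0.
  rewrite /from_above; case: ifP => // b1 ht; apply: IH; apply: contra ht => /eqP->.
  by rewrite odd_below_next //; case: even_band; rewrite /= ?addn0 ?addn1 // !oddD /= negbK.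
have delay_odd (F : nat -> K) : (forall t, s = t.+1 -> F t = 0) -> delay 1 F s = 0.
  by case: s {h} => [|s] hF; [rewrite delay_small | rewrite delayS delay0 hF].
case: x h => /= h; rewrite ?pgfS_true ?pgfS_false.
  rewrite below ?add0r; last by rewrite addn0 in h.
  rewrite delay_odd ?mulr0 // => t es; apply: above; move: h.
  by rewrite es !oddD /=; case: (odd t); case: (odd (odd_below p p' b)); case: (odd (odd_below p p' a)); case: (~~ ty).
rewrite above ?addr0; last by rewrite addn1 in h.
rewrite delay_odd ?mulr0 // => t es; apply: below; move: h.
by rewrite es !oddD /=; case: (odd t); case: (odd (odd_below p p' b)); case: (odd (odd_below p p' a)); case: (~~ ty).
Qed.

Lemma pgf_overflow p p' a ty L u s : start_ok p p' a ty -> (0 < a < p')%N -> (L < s)%N ->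
  pgf v p p' a ty L ty a u s = 0.
Proof.
move=> ok ha; case: L => [|L] Ls.
  by rewrite pgf0 addbb (gtn_eqF Ls) !andbF.
case: s Ls => // s Ls.
have [PA QA] := from_overflow v ok u ha (ltnW Ls : (L < s.+1)%N).
have [PB QB] := from_overflow v ok u ha (Ls : (L < s)%N).
suff all0 x : pgf v p p' a ty L.+1 x a u s.+1 = 0 by apply: all0.
by case: x; rewrite ?pgfS_true ?pgfS_false delayS delay0 ?PA ?QA ?PB ?QB ?mulr0 ?addr0.
Qed.

Lemma half_pgf_overflow p p' a ty lam sig : start_ok p p' a ty -> (0 < a < p')%N ->
  (lam < sig)%N -> half_pgf p p' a ty lam sig = 0.
Proof. by move=> ok ha ls; apply: pgf_overflow => //; rewrite ltn_double. Qed.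

(** A closed path starts and ends at the same level, so the [2 sig] added steps split evenly:
    [i = sig]. *)
Lemma half_pgf_burge p p' a ty kap sig : generic v -> (0 < p)%N -> (p < p')%N ->
  (0 < a < p')%N ->
  start_ok p (p' + p) (a + (odd_below p p' a + ~~ ty)) ty ->
  half_pgf p (p' + p) (a + (odd_below p p' a + ~~ ty)) ty (kap + sig) sig =
  v ^+ (sig ^ 2) *
  \sum_(n < sig.+1) qbin v kap.*2 n * half_pgf p p' a ty kap (sig - n).
Proof.
move=> gv p0 pp ha ok.
rewrite /half_pgf doubleD PoszD {2}addnA.
rewrite (burge gv p0 pp ok) //; last by rewrite -muln2 PoszM; lia.
congr (_ * _); first by rewrite exprnP; congr (v ^ _); rewrite -muln2 PoszM -mulnn PoszM; lia.
rewrite (@qconv_widen _ _ _ _ _ sig.+1); last by lia.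
apply: eq_bigr => -[n /= hn] _; congr (_ * _).
by rewrite /delay leq_double -ltnS hn doubleB.
Qed.

End HalfLength.

Lemma half_pgf_dual (K : fieldType) (v : K) p p' a ty lam sig :
  v != 0 -> coprime p p' -> (p < p')%N ->
  start_ok p p' a ty -> start_ok (p' - p) p' a (~~ ty) ->
  (0 < a < p')%N -> (sig <= lam)%N ->
  half_pgf v (p' - p) p' a (~~ ty) lam sig =
  v ^+ (lam ^ 2) * half_pgf v^-1 p p' a ty lam (lam - sig).
Proof.
move=> v0 cop pp ok ok' ha sl.
rewrite /half_pgf pgf_dual ?leq_double // negbK doubleB; congr (_ * _).
by rewrite exprnP; congr (v ^ _); rewrite -mulnn PoszM -addnn PoszD addrK.
Qed.

(** * Starting heights next to an odd band *)

Section StartingPoint.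
Variables (p p' a r0 : nat) (ty : bool).
Hypotheses (p_gt0 : (0 < p)%N) (p_lt : (p < p')%N) (a_in : (0 < a < p')%N).
Hypothesis near : if ty then (p * a = p' * r0 + 1)%N else (p * a + 1 = p' * r0)%N.

Lemma odd_below_start : (odd_below p p' a + ~~ ty)%N = r0.
Proof.
case: ty near => /= h.
  by rewrite addn0; apply: divn_uniq; nia.
case: r0 h => [|r] h; first by lia.
by rewrite addn1; congr S; apply: divn_uniq; nia.
Qed.

Lemma start_ok_near : start_ok p p' a ty.
Proof.
have fa := odd_below_start; have fN := odd_below_next p_gt0 p_lt a.
split=> ha.
- have : odd_below p p' a.+1 = r0.
    case: ty near => /= h; last by apply: divn_uniq; nia.
    (* The floor must not jump from [a] to [a.+1], which needs [p + 1 < p']. If [p + 1 = p'], then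
       [a = p' - 1], and there is no band above [a]. *)
    have p1 : p.+1 != p'.
      apply/eqP => e; move: h; rewrite -e mulSn => h.
      have r0a : (r0 < a)%N by nia.
      have : (p * (a - r0) = r0 + 1)%N by rewrite mulnBr; lia.
      by have : (p <= p * (a - r0))%N by [rewrite leq_pmulr; lia]; lia.
    by apply: divn_uniq; nia.
  by move: fN fa; case: even_band; case: ty => /=; lia.
- have [c ec] : exists c, a = c.+1 by exists a.-1; lia.
  have := odd_below_next p_gt0 p_lt c; rewrite -ec => fc.
  have : (odd_below p p' c).+1 = r0.
    suff -> : odd_below p p' c = r0.-1.
      by case: ty near => /= h; case: r0 h => [|r] h //; nia.
    by apply: divn_uniq; case: ty near => /= h; nia.
  by rewrite ec /=; move: fc fa; case: even_band; case: ty => /=; lia.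
Qed.
End StartingPoint.

(** * The fermionic recursion *)

Section Fermionic.
Variables (K : fieldType) (v : K).

(** [gauss] at an arbitrary point of a field, since duality also evaluates it at [q^-1]. *)
Definition qgauss (A B : int) : K :=
  if (0 <= B) && (B <= A) then
    qfact v `|A|%N / (qfact v `|B|%N * qfact v `|A - B|%N)
  else 0.

(** The share of one row of [C] in the exponent; [t] tells whether this row is a turn, and [m0],
    [m1] are its own halved variable and the next one. *)
Definition fexp (t : bool) (m0 m1 : nat) : int :=
  if t then m1%:Z ^+ 2 else (m0%:Z - m1%:Z) ^+ 2.

(** The upper entry [m_j - (C m)_j / 2], with [m0], [m1], [m2] the halved variables at [j - 1], [j],
    [j + 1] and [t] the flag of row [j]. *)
Definition ftop (t : bool) (m0 m1 m2 : nat) : int :=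
  if t then m0%:Z + m1%:Z - m2%:Z else m0%:Z + m2%:Z.

(* All summation variables are halved: [m0 = L / 2], [m1 = m_1 / 2], etc.; the
   bound [m2 <= m1] loses nothing since the other terms vanish. *)
Fixpoint fsum (ts : seq bool) (m0 m1 : nat) : K :=
  if ts is t :: ts' then
    v ^ fexp t m0 m1 *
    \sum_(m2 < m1.+1) qgauss (ftop (head false ts') m0 m1 m2) m1.*2 * fsum ts' m1 m2
  else ((m0 == 0%N) && (m1 == 0%N))%:R.

Lemma qgaussD l n : qgauss (l + n)%N l = qbin v l n.
Proof.
rewrite /qgauss /= lez_nat leq_addr; congr (_ / (_ * qfact v _)).
by rewrite PoszD addrAC subrr add0r.
Qed.

Lemma qgauss_small (A B : int) : A < B -> qgauss A B = 0.
Proof. by move=> h; rewrite /qgauss leNgt [B <= A]leNgt h andbF. Qed.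

Lemma fsum_eq0 ts m0 m1 : (m0 < m1)%N -> fsum ts m0 m1 = 0.
Proof.
case: ts => [|t ts] h /=; first by case: m1 h => // m1; rewrite andbF.
rewrite big1 ?mulr0 // => m2 _; rewrite qgauss_small ?mul0r //.
by have := ltn_ord m2; rewrite /ftop; case: head; lia.
Qed.

End Fermionic.
Arguments qgauss : simpl never.

Lemma qgauss_inv (K : fieldType) (v : K) (A B : int) : generic v ->
  qgauss v^-1 A B = v ^ (- (B * (A - B))) * qgauss v A B.
Proof.
move=> gv; case: (boolP ((0 <= B) && (B <= A))) => h; last first.
  by rewrite /qgauss (negbTE h) mulr0.
have [l eB] : exists l : nat, B = l by exists `|B|%N; lia.
have [n eA] : exists n : nat, A = (l + n)%N by exists `|A - B|%N; lia.
rewrite eA eB !qgaussD qbin_inv // -[(l + n)%:Z - l%:Z]/(_) PoszD addrAC subrr add0r.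
by rewrite -PoszM -invr_expz.
Qed.

(** Only the first flag toggles: the powers of [v] released by the Gaussian polynomials restore the
    flags of the later rows. *)
Lemma fsum_inv (K : fieldType) (v : K) t ts m0 m1 : generic v ->
  fsum v^-1 (t :: ts) m0 m1 = v ^ (- (m0%:Z ^+ 2)) * fsum v (~~ t :: ts) m0 m1.
Proof.
move=> gv; have v0 := gv.1; elim: ts t m0 m1 => [|t1 ts IH] t m0 m1 /=.
  rewrite !mulr_sumr; apply: eq_bigr => -[m2 /= _] _.
  case: (eqVneq m1 0%N) => [->|_] /=; last by rewrite !mulr0.
  rewrite qgauss_inv // exprz_inv; move: (qgauss v _ _) => G.
  rewrite !mulrA -!expfzDr //; congr (v ^ _ * _ * _).
  by rewrite /fexp; case: t => /=; lia.
rewrite !mulr_sumr; apply: eq_bigr => m2 _.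
have := IH t1 m1 m2; rewrite /= => ->.
(* [S] does not involve [t1], so toggling [t1] affects only a power of [v]. *)
set S := \sum_(_ < _) _.
rewrite qgauss_inv // exprz_inv; move: (qgauss v _ _) => G.
have lhs (a b c d : int) : v ^ a * (v ^ b * G * (v ^ c * (v ^ d * S))) =
    v ^ (a + b + c + d) * (G * S) by rewrite !expfzDr //; ring.
have rhs (a b c : int) : v ^ a * (v ^ b * (G * (v ^ c * S))) =
    v ^ (a + b + c) * (G * S) by rewrite !expfzDr //; ring.
rewrite lhs rhs; congr (v ^ _ * _).
by rewrite /fexp /ftop; case: t; case: (t1) => /=; lia.
Qed.

(* The rows of [C], with [true] at the indices [t_mu]. *)
Fixpoint turns (cs : seq nat) : seq bool :=
  match cs with
  | [::] => [::]
  | [:: c] => nseq (c - 2) false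
  | c :: cs' => nseq c.-1 false ++ true :: turns cs'
  end.

Definition cf_ok (cs : seq nat) : bool := all (leq 1) cs && (1 < last 0 cs)%N.

Lemma cf_val_gt1 cs : cf_ok cs -> 1 < cf_val cs.
Proof.
rewrite /cf_ok; elim: cs => [|c [|d cs] IH]; first by [].
  by rewrite /= ltr1n andbT => /andP[].
case/andP=> /= /andP[c1 a1] l1; rewrite -/(cf_val (d :: cs)).
have h : 1 < cf_val (d :: cs) by apply: IH; rewrite /= a1.
have c1' : 1 <= c%:R :> rat by rewrite ler1n.
by apply: ltr_pwDr => //; rewrite divr_gt0 //; apply: lt_trans h.
Qed.

Lemma cf_val_succ c cs : cf_val (c.+1 :: cs) = cf_val (c :: cs) + 1.
Proof. by case: cs => [|d cs] /=; rewrite -addn1 natrD // addrAC. Qed.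

Lemma turns_succ c cs : ((if cs is [::] then 1 else 0) < c)%N ->
  turns (c.+1 :: cs) = false :: turns (c :: cs).
Proof. by case: cs => [|d cs]; case: c => [|[|c]] //= _; rewrite ?subn2. Qed.

(** Duality on continued fractions: if [1, d, ...] belongs to [p'/p], then [d + 1, ...] belongs to
    [p'/(p' - p)]. The rows differ in the first flag only, as in [fsum_inv]. *)
Lemma turns_one d cs : ((if cs is [::] then 1 else 0) < d)%N ->
  exists ts, turns [:: 1, d & cs] = true :: ts /\ turns (d.+1 :: cs) = false :: ts.
Proof. by move=> h; exists (turns (d :: cs)); rewrite turns_succ. Qed.

(* The scoring vertices that correspond to [m_1 = 2 mu]: [m_1] counts them
   when [c_0 = 1], and counts the non-scoring vertices when [c_0 > 1]. *)
Definition first_part (cs : seq nat) (lam mu : nat) : nat :=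
  if head 0%N cs == 1%N then mu else (lam - mu)%N.

Lemma turns_head c cs : cf_ok (c :: cs) -> head false (turns (c :: cs)) = (c == 1%N).
Proof.
rewrite /cf_ok; case: cs => [|d cs] /=; last by case: c => [|[|c]].
by case: c => [|[|[|c]]].
Qed.

(** The convolution index of the Burge transform becomes the next summation variable, up to reversal
    when [c > 1]. *)
Lemma fsum_step (K : fieldType) (v : K) c cs p p' a ty lam mu :
  generic v -> cf_ok (c :: cs) -> (mu <= lam)%N ->
  (forall l m, (l < m)%N -> half_pgf v p p' a ty l m = 0) ->
  (forall l m, (m <= l)%N ->
     half_pgf v p p' a ty l (first_part (c :: cs) l m) = fsum v (turns (c :: cs)) l m) ->
  v ^+ ((lam - mu) ^ 2) *
  \sum_(n < (lam - mu).+1) qbin v mu.*2 n * half_pgf v p p' a ty mu (lam - mu - n) =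
  fsum v (false :: turns (c :: cs)) lam mu.
Proof.
move=> gv ok ml W0 IH; rewrite /= -/(turns (c :: cs)).
have -> : v ^ fexp false lam mu = v ^+ ((lam - mu) ^ 2).
  by rewrite exprnP; congr (v ^ _); rewrite /fexp subzn // -mulnn PoszM expr2.
congr (_ * _); set s := (lam - mu)%N.
(* The term of old paths with [2 n] scoring vertices. It vanishes for [n > s] and for [n > mu], so
   either bound may end the sum. *)
pose G n := if (n <= s)%N then qbin v mu.*2 (s - n) * half_pgf v p p' a ty mu n else 0.
have widen n m : (n <= m)%N -> (forall i, (n <= i)%N -> G i = 0) ->
    \sum_(i < n) G i = \sum_(i < m) G i.
  move=> nm G0; rewrite -!(big_mkord xpredT G) (big_cat_nat (n := n) _ nm) //=.
  rewrite [X in _ + X]big_nat_cond [X in _ + X]big1 ?addr0 // => i hi.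
  by apply: G0; lia.
transitivity (\sum_(n < s.+1) G n).
  rewrite (reindex_inj rev_ord_inj) /=; apply: eq_bigr => -[n /= hn] _.
  rewrite /G subSS ifT; last by lia.
  by congr (_ * half_pgf _ _ _ _ _ _ _); lia.
transitivity (\sum_(n < mu.+1) G n).
  rewrite (widen s.+1 (s + mu).+1); first last.
  - by move=> i hi; rewrite /G ifF //; lia.
  - by lia.
  rewrite (widen mu.+1 (s + mu).+1) //; first by lia.
  by move=> i hi; rewrite /G W0 ?mulr0 //; case: ifP.
have term m2 : (m2 <= mu)%N ->
   qgauss v (ftop (c == 1%N) lam mu m2) mu.*2 * fsum v (turns (c :: cs)) mu m2 =
   G (first_part (c :: cs) mu m2).
  move=> h; rewrite -IH // /G /first_part /ftop /=; case: eqP => c1; case: (leqP _ s) => h2.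
  - rewrite -qgaussD; congr (qgauss v _ _ * _); lia.
  - by rewrite qgauss_small ?mul0r //; lia.
  - rewrite -qgaussD; congr (qgauss v _ _ * _); lia.
  - by rewrite qgauss_small ?mul0r //; lia.
rewrite turns_head //.
rewrite [RHS](eq_bigr (fun i : 'I_mu.+1 => G (first_part (c :: cs) mu i))); last first.
  by move=> i _; apply: term; rewrite -ltnS.
rewrite /first_part /=; case: eqP => // _.
rewrite (reindex_inj rev_ord_inj) /=; apply: eq_bigr => i _; congr G; lia.
Qed.

(** Induction on [p + p'], for all [v] because duality passes to [v^-1]. If [c_0 = 1], then
    [p' < 2 p] and duality leads to the smaller pair [(p' - p, p')]. If [c_0 > 1], the path model is
    a Burge image of [(p, p' - p)], except for the base case [(1, 2)]. *)
Lemma half_pgf_fsum (K : fieldType) n (v : K) p p' a r0 ty cs lam mu :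
  (p + p' <= n)%N -> generic v -> (0 < p)%N -> (p < p')%N -> coprime p p' -> (0 < a < p')%N ->
  (if ty then p * a = p' * r0 + 1 else p * a + 1 = p' * r0)%N ->
  cf_ok cs -> cf_val cs = p'%:R / p%:R -> (mu <= lam)%N ->
  half_pgf v p p' a ty lam (first_part cs lam mu) = fsum v (turns cs) lam mu.
Proof.
elim: n v p p' a r0 ty cs lam mu => [|n IH] v p p' a r0 ty cs lam mu hn gv p0 pp cop ha near ok val ml.
  by lia.
have sok := start_ok_near p0 pp ha near.
have cop0 : coprime p (p' - p) by rewrite /coprime -gcdnDl subnKC // ltnW.
have p0Q : p%:R != 0 :> rat by rewrite pnatr_eq0; lia.
case: cs ok val => [|c cs] ok val; first by [].
have c0 : (0 < c)%N by case/andP: ok => /= /andP[].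
case: (eqVneq c 1%N) => [c1|cn1].
  subst c; case: cs ok val => [|d cs] ok val; first by [].
  have okd : cf_ok (d :: cs) by [].
  have d1 : ((if cs is [::] then 1 else 0) < d)%N.
    by case/andP: okd; case: (cs) => [|? ?] /= /andP[].
  have oks : cf_ok (d.+1 :: cs).
    move: okd; rewrite /cf_ok; case: (cs) => [|e es] /=; first by rewrite !andbT; lia.
    by case/andP=> /andP[_ ->] ->.
  have y1 := cf_val_gt1 okd; set y := cf_val (d :: cs) in y1.
  have yP : y * (p'%:R - p%:R) = p%:R.
    have y0 : y != 0 by rewrite gt_eqF // (lt_trans _ y1).
    have -> : p'%:R = (1 + 1 / y) * p%:R :> rat.
      by rewrite -[1 + _]/(cf_val [:: 1%N, d & cs]) val divfK.
    by field.
  have pp2 : (p' - p < p)%N.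
    rewrite -(ltr_nat rat) natrB; last by lia.
    rewrite -{2}yP ltr_pMl // subr_gt0 ltr_nat //.
  have vals : cf_val (d.+1 :: cs) = p'%:R / (p' - p)%:R.
    rewrite cf_val_succ -/y natrB; last by lia.
    have h : p'%:R - p%:R != 0 :> rat by rewrite subr_eq0 eqr_nat; lia.
    by apply: (mulIf h); rewrite divfK // mulrDl yP mul1r addrC subrK.
  have copd : coprime (p' - p) p'.
    by rewrite -[X in coprime _ X](subnK (ltnW pp)) /coprime gcdnDl gcdnC.
  (* [(p' - p) a - p' (a - r0) = - (p a - p' r0)]: the start stays and [ty] flips. *)
  have neard : if ~~ ty then ((p' - p) * a = p' * (a - r0) + 1)%N
               else ((p' - p) * a + 1 = p' * (a - r0))%N.
    have r0a : (r0 <= a)%N by case: (ty) near => near; nia.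
    by rewrite mulnBl mulnBr; case: (ty) near => /= near; nia.
  have pd0 : (0 < p' - p)%N by lia.
  have pdp : (p' - p < p')%N by lia.
  have sokd := start_ok_near pd0 pdp ha neard.
  have [ts [-> tsd]] := turns_one d1.
  have hnd : (p' - p + p' <= n)%N by lia.
  have := IH v^-1 _ _ _ _ _ _ lam mu hnd (generic_inv gv) pd0 pdp copd ha neard oks vals ml.
  have -> : first_part (d.+1 :: cs) lam mu = (lam - mu)%N.
    by rewrite /first_part ifF //=; apply/eqP; lia.
  rewrite tsd (fsum_inv _ _ _ _ gv) => IHd; rewrite -[first_part _ _ _]/mu.
  have := @half_pgf_dual _ v (p' - p) p' a (~~ ty) lam mu gv.1 copd pdp sokd.
  rewrite negbK subKn; last by lia.
  move=> -> //; rewrite IHd mulrA exprnP -expfzDr ?gv.1 //=.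
  rewrite [X in v ^ X](_ : _ = 0) ?expr0z ?mul1r //.
  by rewrite -mulnn PoszM expr2 subrr.
have c1 : (1 < c)%N by lia.
have -> : first_part (c :: cs) lam mu = (lam - mu)%N by rewrite /first_part /= (negbTE cn1).
(* For [(1, 2)] the only height is 1, so only the empty path exists. *)
case: (altP (c :: cs =P [:: 2])) => [e2|ne2].
  move: val; rewrite e2 /= => val.
  have p2 : p' = (2 * p)%N.
    by apply/eqP; rewrite -(eqr_nat rat) natrM val divfK.
  have p1 : p = 1%N by move: cop; rewrite p2 /coprime gcdnMl => /eqP.
  have a1 : a = 1%N by lia.
  rewrite p2 p1 a1; case: lam ml => [|lam] ml.
    have -> : mu = 0%N by lia.
    by rewrite /half_pgf pgf0 addbb.
  rewrite /half_pgf doubleS.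
  suff z x u s : pgf v 1 (2 * 1) 1 ty (lam.*2.+2) x 1 u s = 0 by rewrite z.
  by case: x; rewrite ?pgfS_true ?pgfS_false /from_below /from_above /delay /= if_same mulr0 addr0.
have [c' ec] : exists c', c = c'.+1 by exists c.-1; lia.
subst c.
have oks : cf_ok (c' :: cs).
  move: ok ne2; rewrite /cf_ok eqseq_cons; case: (cs) => [|e es] /=.
    by rewrite eqxx !andbT; lia.
  by case/andP=> /andP[-> ->] -> _; rewrite !andbT; lia.
have cc : ((if cs is [::] then 1 else 0) < c')%N.
  by case/andP: oks; case: (cs) => [|? ?] /= /andP[].
have vals : cf_val (c' :: cs) = (p' - p)%:R / p%:R.
  rewrite natrB; last by lia.
  by rewrite mulrBl divff // -val cf_val_succ addrK.
have pps : (p < p' - p)%N.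
  have := cf_val_gt1 oks; rewrite vals ltr_pdivlMr ?mul1r ?ltr_nat // ltr0n //.
(* [p (a - r0) - (p' - p) r0 = p a - p' r0]: the start moves to [a - r0], with the same [r0] and
   [ty]. *)
have near0 : if ty then (p * (a - r0) = (p' - p) * r0 + 1)%N else (p * (a - r0) + 1 = (p' - p) * r0)%N.
  have r0a : (r0 <= a)%N by case: (ty) near => near; nia.
  by rewrite mulnBl mulnBr; case: (ty) near => /= near; nia.
have r0p : (r0 <= p)%N by case: (ty) near => near; nia.
have ha0 : (0 < a - r0 < p' - p)%N.
  by case: (ty) near0 => near0; nia.
have sok0 := start_ok_near p0 pps ha0 near0.
have fa0 := odd_below_start p0 pps ha0 near0.
rewrite turns_succ // -(@fsum_step _ _ _ _ p (p' - p) (a - r0) ty) //; first last.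
- move=> l m ml'; apply: (IH v p (p' - p)%N (a - r0)%N r0 ty) => //; lia.
- by move=> l m; apply: half_pgf_overflow.
have e1 : (p' - p + p = p')%N by lia.
have e2 : (a - r0 + r0 = a)%N by case: (ty) near => near; nia.
have e3 : (mu + (lam - mu) = lam)%N by lia.
by rewrite -half_pgf_burge // fa0 e1 e2 ?e3.
Qed.

(** * The paths of [chi] *)

Lemma q_generic : generic q.
Proof.
split=> [|n n0]; first by rewrite /q tofrac_eq0 polyX_eq0.
rewrite /q -tofracXn -tofrac1 tofrac_eq.
apply/eqP => /(congr1 (fun r : {poly int} => size r)).
by rewrite size_polyXn size_poly1 => -[e]; rewrite e in n0.
Qed.

Lemma reindex_rcons (V : nmodType) (T : finType) n (F : n.+1.-tuple T -> V) :
  \sum_h F h = \sum_(x : T) \sum_(h : n.-tuple T) F [tuple of rcons h x].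
Proof.
rewrite exchange_big pair_bigA /=.
apply: (reindex (fun z : n.-tuple T * T => [tuple of rcons z.1 z.2])).
apply: onW_bij; apply: inj_card_bij; last by rewrite card_prod !card_tuple expnSr.
move=> [h x] [h' x'] /= /(congr1 val) /= /rcons_inj [e ->].
by congr (_, _); apply: val_inj.
Qed.

Section PathSum.
Variables (p p' a : nat).

(** The deleted last height [x] becomes the extra height beyond the end of the shorter path, hence
    the default value [x]. *)
Lemma hgt_rcons c L (h : L.+1.-tuple 'I_p') (x : 'I_p') i : (i <= L.+1)%N ->
  hgt c [tuple of rcons h x] i = hgt x h i.
Proof.
move=> iL; rewrite /hgt /= map_rcons nth_rcons size_map size_tuple.
case: ltngtP iL => // [iL|->] _; first by apply: set_nth_default; rewrite size_map size_tuple.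
by rewrite nth_default // size_map size_tuple.
Qed.

Lemma hgt_last c L (h : L.+1.-tuple 'I_p') : hgt c h L.+1 = c.
Proof. by rewrite /hgt nth_default // size_map size_tuple. Qed.

Lemma is_pathP b c L (h : L.+1.-tuple 'I_p') :
  reflect [/\ forall i, (i <= L)%N -> (0 < hgt c h i)%N,
    forall i, (i < L)%N -> hgt c h i.+1 = (hgt c h i).+1 \/ hgt c h i = (hgt c h i.+1).+1,
    hgt c h 0 = a & hgt c h L = b] (is_path a b c h).
Proof.
apply: (iffP and4P) => -[h1 h2 h3 h4]; split; try exact/eqP.
- by move=> i iL; have /forallP /(_ (Ordinal (iL : (i < L.+1)%N))) := h1.
- by move=> i iL; have /forallP /(_ (Ordinal iL)) /eqP /= := h2; lia.
- by apply/forallP => i; apply: h1; rewrite -ltnS.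
- by apply/forallP => i; apply/eqP; have := h2 _ (ltn_ord i); lia.
Qed.

Lemma is_path_rcons b c L (h : L.+1.-tuple 'I_p') (x : 'I_p') : (0 < b)%N ->
  is_path a b c [tuple of rcons h x] =
  (x == b :> nat) && ((1 < b)%N && is_path a b.-1 b h || (b.+1 < p')%N && is_path a b.+1 b h).
Proof.
move=> b0; have hx : hgt c [tuple of rcons h x] L.+1 = x by rewrite hgt_rcons ?hgt_last.
case: (eqVneq (x : nat) b) => [xb|xb] /=; last first.
  by apply/is_pathP => -[_ _ _]; rewrite hx => e; rewrite e eqxx in xb.
have hg i : (i <= L)%N -> hgt c [tuple of rcons h x] i = hgt b h i.
  by move=> iL; rewrite hgt_rcons ?xb // ltnW.
have hlt : (hgt b h L < p')%N.
  by rewrite /hgt (nth_map x) ?size_tuple.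
apply/is_pathP/orP => [[h1 h2 h3 h4]|H].
- have g1 i : (i <= L)%N -> (0 < hgt b h i)%N by move=> iL; rewrite -hg //; apply: h1; lia.
  have g2 i : (i < L)%N -> hgt b h i.+1 = (hgt b h i).+1 \/ hgt b h i = (hgt b h i.+1).+1.
    by move=> iL; rewrite -!hg //; [apply: h2; lia | lia].
  have g3 : hgt b h 0 = a by rewrite -hg.
  have := h2 L (ltnSn L); rewrite hx hg // xb => -[e|e].
    left; apply/andP; split; first by have := g1 L (leqnn L); lia.
    by apply/is_pathP; split=> //; lia.
  right; apply/andP; split; first by lia.
  by apply/is_pathP; split.
- have [[g1 g2 g3] g4] : [/\ forall i, (i <= L)%N -> (0 < hgt b h i)%N,
    forall i, (i < L)%N -> hgt b h i.+1 = (hgt b h i).+1 \/ hgt b h i = (hgt b h i.+1).+1 &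
    hgt b h 0 = a] /\ (hgt b h L = b.+1 \/ b = (hgt b h L).+1).
    case: H => /andP[hb /is_pathP[g1 g2 g3 g4]]; split=> //; first by right; lia.
    by left.
  split; last by rewrite hx.
  + move=> i; rewrite leq_eqVlt ltnS => /orP[/eqP->|iL]; first by rewrite hx xb.
    by rewrite hg ?g1.
  + move=> i; rewrite ltnS leq_eqVlt => /orP[/eqP->|iL]; first by rewrite hx hg // xb; lia.
    by rewrite !hg //; [apply: g2 | apply: ltnW].
  + by rewrite hg.
Qed.

Lemma wt_rcons c L (h : L.+1.-tuple 'I_p') (x : 'I_p') :
  wt p a c [tuple of rcons h x] =
  wt p a x h + vertex_weight p a c [tuple of rcons h x] L.+1.
Proof.
rewrite /wt big_nat_recr //=; congr (_ + _).
rewrite !big_nat; apply: eq_bigr => i /andP[i1 iL].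
by rewrite /vertex_weight /scoring /straight /xcoord /ycoord !hgt_rcons //; lia.
Qed.

(** The flag [x] of [pgf] for a vertex at height [b] that is left upwards or downwards. *)
Definition facing_even (b : nat) (up : bool) : bool :=
  if up then even_band p p' b else ~~ even_band p p' b.-1.

Definition faced (b : nat) (up : bool) : nat := if up then b.+1 else b.-1.

Lemma last_weight b up L (h : L.+1.-tuple 'I_p') (x : 'I_p') (u : int) (from_up : bool) :
  (0 < b)%N -> x = b :> nat -> u + u = L.+1%:Z + b%:Z - a%:Z ->
  hgt b h L = faced b from_up ->
  vertex_weight p a (faced b up) [tuple of rcons h x] L.+1 =
  if facing_even b up == from_up then (if from_up then u else L.+1%:Z - u) else 0.
Proof.
move=> b0 xb hu hL; rewrite /vertex_weight /scoring /straight /xcoord /ycoord.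
have h0 : hgt (faced b up) [tuple of rcons h x] L.+1.-1 = faced b from_up.
  by rewrite hgt_rcons /= ?xb.
have h1 : hgt (faced b up) [tuple of rcons h x] L.+1 = b.
  by rewrite hgt_rcons ?hgt_last.
rewrite h0 h1 hgt_last.
have hY : ((L.+1%:Z + (b%:Z - a%:Z)) %/ 2)%Z = u by lia.
have hX : ((L.+1%:Z - (b%:Z - a%:Z)) %/ 2)%Z = L.+1%:Z - u by lia.
rewrite hX hY.
have -> : (b == (faced b from_up).+1) = ~~ from_up.
  by case: from_up {hL h0} => /=; lia.
have -> : minn b (faced b up) = if up then b else b.-1 by case: up {h0 h1} => /=; lia.
have -> : (faced b from_up != faced b up) = (from_up != up).
  by case: from_up {hL h0}; case: up {h1} => /=; lia.
rewrite /facing_even; case: from_up {hL h0}; case: up {h1} => /=;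
  case: even_band => //=.
Qed.

Definition step_weight (b : nat) (up from_up : bool) (L : nat) (u : int) : int :=
  if facing_even b up == from_up then (if from_up then u else L.+1%:Z - u) else 0.

Lemma chi_step b up L (u : int) : (0 < b < p')%N -> u + u = L.+1%:Z + b%:Z - a%:Z ->
  chi p p' a b (faced b up) L.+1 =
  (if (1 < b)%N then q ^ step_weight b up false L u * chi p p' a b.-1 b L else 0) +
  (if (b.+1 < p')%N then q ^ step_weight b up true L u * chi p p' a b.+1 b L else 0).
Proof.
case/andP=> b0 bp hu; have q0 := q_generic.1.
rewrite /chi big_mkcond reindex_rcons (bigD1 (Ordinal bp)) //=.
rewrite [X in _ + X]big1 ?addr0; last first.
  move=> x xb; rewrite big1 // => h _; rewrite is_path_rcons //.
  by rewrite (_ : (x == b :> nat) = false) //; apply: contra_neqF xb => /eqP xb; apply: val_inj.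
have side (up' ok : bool) b' : b' = faced b up' ->
    (if ok then q ^ step_weight b up up' L u * \sum_(h : L.+1.-tuple 'I_p' | is_path a b' b h) q ^ wt p a b h else 0) =
    \sum_(h : L.+1.-tuple 'I_p') if ok && is_path a b' b h
       then q ^ wt p a (faced b up) [tuple of rcons h (Ordinal bp)] else 0.
  move=> eb'; case: ok => /=; last by rewrite big1.
  rewrite mulr_sumr big_mkcond; apply: eq_bigr => h _; case: ifP => // /is_pathP[_ _ _ hL].
  rewrite wt_rcons (@last_weight b up L h (Ordinal bp) u up') //; last by rewrite hL.
  by rewrite [in RHS]addrC expfzDr.
rewrite (side false _ _ erefl) (side true _ _ erefl) -big_split /=.
apply: eq_bigr => h _; rewrite is_path_rcons // eqxx /=.
case: (boolP (_ && is_path a b.-1 b h)) => /= [/andP[b1 /is_pathP[_ _ _ hL]]|_]; last by rewrite add0r.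
rewrite ifF ?addr0 //; apply/negP => /andP[_ /is_pathP[_ _ _]]; rewrite hL; lia.
Qed.

Variable ty : bool.
Hypothesis start : start_ok p p' a ty.

(** The condition at [b = a] excludes the fictitious initial value; every other state is reached by
    actual paths only. *)
Lemma chi_pgf b up L (u : int) : (0 < b < p')%N -> (b = a -> facing_even b up = ty) ->
  u + u = L%:Z + b%:Z - a%:Z ->
  chi p p' a b (faced b up) L = \sum_(s < L.+1) pgf q p p' a ty L (facing_even b up) b u s.
Proof.
elim: L b up u => [|L IH] b up u hb real hu.
  rewrite big_ord1 pgf0; case: (eqVneq b a) => [ba|ba] /=; last first.
    by rewrite /chi big1 // => h /is_pathP[_ _ -> /eqP]; rewrite eq_sym (negbTE ba).
  have -> : u = 0 by lia.
  rewrite real // addbb eqxx /=.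
  have bp : (b < p')%N by case/andP: hb.
  rewrite /chi (big_pred1 [tuple Ordinal bp]); first by rewrite /wt big_geq // expr0z.
  move=> h; apply/is_pathP/eqP => [[_ _ h0 _]|->].
    apply/val_inj; case: (tupleP h) h0 => x t; rewrite (tuple0 t) /hgt /= => h0.
    by congr [:: _]; apply: val_inj; rewrite /= h0 ba.
  by rewrite /hgt /=; split=> // i; rewrite leqn0 => /eqP-> /=; case/andP: hb.
rewrite (chi_step _ hb hu).
have below : (if (1 < b)%N then chi p p' a b.-1 b L else 0) =
    \sum_(s < L.+1) from_below q p p' a ty L b u s.
  rewrite /from_below; case: ifP => b1; last by rewrite big1.
  have := IH b.-1 true (u - 1); rewrite /faced /facing_even prednK; last by lia.
  by apply; [lia | move=> e; rewrite e; apply: start.1; lia | lia].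
have above : (if (b.+1 < p')%N then chi p p' a b.+1 b L else 0) =
    \sum_(s < L.+1) from_above q p p' a ty L b u s.
  rewrite /from_above; case: ifP => b1; last by rewrite big1.
  have := IH b.+1 false u; rewrite /faced /facing_even /=.
  apply; [lia | | lia].
  by move=> e; rewrite -[b]/(b.+1.-1) e start.2 ?negbK //; lia.
(* The undelayed terms vanish at [s = L.+1] and the delayed ones at [s = 0]. *)
have [oP oQ] := from_overflow q start u hb (ltnSn L).
have plain (F : nat -> Kq) : F L.+1 = 0 -> \sum_(s < L.+2) F s = \sum_(s < L.+1) F s.
  by move=> F0; rewrite big_ord_recr /= F0 addr0.
have shifted (F : nat -> Kq) : \sum_(s < L.+2) delay 1 F s = \sum_(s < L.+1) F s.
  by rewrite big_ord_recl delay_small // add0r; apply: eq_bigr => s _; rewrite lift0 delayS delay0.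
have pull (B : bool) c X : (if B then c * X else 0) = c * (if B then X else 0) :> Kq.
  by case: B; rewrite ?mulr0.
rewrite !pull below above /step_weight.
case: (facing_even b up) => /=.
- under [RHS]eq_bigr do rewrite pgfS_true.
  by rewrite big_split /= plain // -mulr_sumr shifted expr0z mul1r.
- under [RHS]eq_bigr do rewrite pgfS_false.
  by rewrite big_split /= plain // -mulr_sumr shifted expr0z mul1r.
Qed.
End PathSum.

(** * The matrix form of the fermionic sum *)

Lemma reindex_cons (V : nmodType) (T : finType) n (F : n.+1.-tuple T -> V) :
  \sum_h F h = \sum_(x : T) \sum_(h : n.-tuple T) F [tuple of x :: h].
Proof.
rewrite pair_bigA /=.
apply: (reindex (fun z : T * n.-tuple T => [tuple of z.1 :: z.2])).
apply: onW_bij; apply: inj_card_bij; last by rewrite card_prod !card_tuple expnS.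
move=> [x h] [x' h'] /= /(congr1 val) /= [-> e].
by congr (_, _); apply: val_inj.
Qed.

(** Reduces a sum over a possibly infinite set of vectors to a finite type that reaches all nonzero
    terms. *)
Lemma fsbig_finType (V : nmodType) (I : finType) (T : choiceType) (A : set T)
    (g : I -> T) (F : T -> V) :
  injective g -> (forall i, A (g i)) ->
  (forall x, A x -> (forall i, x <> g i) -> F x = 0) ->
  \sum_(x \in A) F x = \sum_i F (g i).
Proof.
move=> g_inj gA F0; rewrite (fsbigE [seq g i | i <- enum I]).
- rewrite big_map big_enum_cond /=; apply: eq_bigl => i.
  by rewrite mem_set.
- by rewrite map_inj_uniq ?enum_uniq.
- by move=> x /= /mapP[i _ ->].
- move=> x Ax /negP xI; apply: F0 => // i xi; apply: xI.
  by rewrite xi map_f // mem_enum.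
Qed.

Section FermionicTerms.
Variables (K : fieldType) (v : K).

Definition fterm (ts : seq bool) (mu : nat -> nat) : K :=
  v ^ (\sum_(j < size ts) fexp (nth false ts j) (mu j) (mu j.+1)) *
  \prod_(j < (size ts).-1)
     qgauss v (ftop (nth false ts j.+1) (mu j) (mu j.+1) (mu j.+2)) (mu j.+1).*2.

Lemma fterm_cons t t1 ts mu : v != 0 ->
  fterm [:: t, t1 & ts] mu =
  v ^ fexp t (mu 0%N) (mu 1%N) * qgauss v (ftop t1 (mu 0%N) (mu 1%N) (mu 2%N)) (mu 1%N).*2
  * fterm (t1 :: ts) (fun j => mu j.+1).
Proof.
move=> v0; rewrite /fterm big_ord_recl expfzDr // [X in _ * X = _]big_ord_recl /=.
by rewrite -!mulrA; congr (_ * _); rewrite mulrCA.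
Qed.

(** The weight [w] carries the factors of rows already peeled off. Ranges widen to [N] by
    [fsum_eq0]; the variable after the last row must be 0, so there is one summation variable fewer
    than rows. *)
Lemma sum_fsum (N : nat) t ts (w : nat -> K) m0 : generic v -> (0 < N)%N ->
  \sum_(m1 < N) w m1 * fsum v (t :: ts) m0 m1 =
  \sum_(x : (size ts).-tuple 'I_N)
    w (nth 0%N (map val x) 0) * fterm (t :: ts) (nth 0%N (m0 :: map val x)).
Proof.
move=> gv; have v0 := gv.1; case: N => // N _; elim: ts t w m0 => [|t1 ts IH] t w m0.
  rewrite (big_pred1 [tuple]) /=; last by move=> x; apply/esym/eqP/val_inj; case: x => -[].
  rewrite (bigD1 ord0) //= [X in _ + X]big1 ?addr0; last first.
    move=> i i0; rewrite big1 ?mulr0 // => m2 _.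
    by rewrite (_ : (i == 0%N :> nat) = false) ?mulr0 //; apply: contra_neqF i0 => /eqP i0; apply: val_inj.
  rewrite /fterm big_ord1 /= big_ord0 big_ord1 /= mulr1.
  have -> // : qgauss v (m0%:Z + 0) 0 = 1.
  by rewrite addr0 -{1}[m0]add0n qgaussD qbin0l.
transitivity (\sum_(m1 < N.+1) \sum_(m2 < N.+1)
    w m1 * (v ^ fexp t m0 m1 * (qgauss v (ftop t1 m0 m1 m2) m1.*2 * fsum v (t1 :: ts) m1 m2))).
  apply: eq_bigr => m1 _; rewrite -!mulr_sumr; congr (_ * (_ * _)).
  pose H m2 := qgauss v (ftop t1 m0 m1 m2) m1.*2 * fsum v (t1 :: ts) m1 m2.
  rewrite -[LHS](big_mkord xpredT H) -[RHS](big_mkord xpredT H).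
  rewrite [RHS](big_cat_nat (n := m1.+1)) //=.
  rewrite [X in _ + X]big_nat_cond [X in _ + X]big1 ?addr0 // => i hi.
  by rewrite /H fsum_eq0 ?mulr0 //; lia.
rewrite [RHS]reindex_cons; apply: eq_bigr => m1 _.
rewrite (eq_bigr (fun m2 : 'I_N.+1 => (w m1 * v ^ fexp t m0 m1 * qgauss v (ftop t1 m0 m1 m2) m1.*2)
   * fsum v (t1 :: ts) m1 m2)); last by move=> m2 _; rewrite !mulrA.
rewrite (IH t1 (fun m2 => w m1 * v ^ fexp t m0 m1 * qgauss v (ftop t1 m0 m1 m2) m1.*2)).
by apply: eq_bigr => x _; rewrite fterm_cons //= !mulrA.
Qed.

End FermionicTerms.

Lemma size_turns cs : cf_ok cs -> size (turns cs) = (sumn cs - 2)%N.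
Proof.
rewrite /cf_ok; elim: cs => [|c [|d cs] IH] //=; first by rewrite size_nseq addn0.
case/andP=> /andP[c0 /andP[d0 a]] l; rewrite size_cat size_nseq -/(turns (d :: cs)) /= IH /= ?d0 ?a //.
have : (2 <= d + sumn cs)%N.
  move: l; case: (cs) a d0 => [|e es] /= a d0; first by rewrite addn0.
  by case/andP: a; lia.
lia.
Qed.

Lemma tmu_cons c cs mu : tmu (c :: cs) mu.+1 = tmu cs mu + c%:Z.
Proof. by rewrite /tmu big_nat_recl //= eqSS; ring. Qed.

Lemma tmu0 cs : cs != [::] -> tmu cs 0 = -1.
Proof. by rewrite /tmu big_geq //; case: cs. Qed.

Lemma tmu_size cs : tmu cs (size cs) = (sumn cs)%:Z - 2.
Proof.
elim: cs => [|c cs IH]; first by rewrite /tmu big_geq.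
by rewrite tmu_cons IH /= PoszD; ring.
Qed.

Lemma is_turnP cs j : reflect (exists2 mu, (0 < mu < size cs)%N & j%:Z = tmu cs mu) (is_turn cs j).
Proof.
apply: (iffP existsP) => [[mu /andP[m0 /eqP e]]|[mu /andP[m0 m1] e]].
  by exists mu; rewrite ?m0 /=.
by exists (Ordinal m1); rewrite /= m0 e eqxx.
Qed.

(** [t_1 = c_0 - 1], and the later [t_mu] are those of the tail shifted by [c_0]. *)
Lemma is_turn_turns cs j : cf_ok cs -> is_turn cs j = nth false (turns cs) j.
Proof.
rewrite /cf_ok; elim: cs j => [|c [|d cs] IH] j //=.
  move=> _; rewrite nth_nseq if_same; apply/negbTE/negP => /is_turnP[mu /=]; lia.
case/andP=> /andP[c0 /andP[d0 a]] l; rewrite -/(turns (d :: cs)).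
have IHd := IH _ (introT andP (conj (introT andP (conj d0 a)) l)).
have ge mu : (mu < size (d :: cs))%N -> (-1 <= tmu (d :: cs) mu).
  by move=> h; rewrite /tmu (ltn_eqF h) subr0 lerDl; apply: sumr_ge0.
rewrite nth_cat size_nseq; case: (ltnP j c.-1) => hj.
  rewrite nth_nseq if_same; apply/negbTE/negP => /is_turnP[[|mu] // /andP[_ hmu]].
  by rewrite tmu_cons; have := ge mu hmu; lia.
case e : (j - c.-1)%N => [|i] /=.
  apply/is_turnP; exists 1%N => //; rewrite tmu_cons tmu0 //; lia.
rewrite -IHd; apply/is_turnP/is_turnP => -[mu hmu hj'].
  case: mu hmu hj' => [|[|mu]] // hmu; rewrite tmu_cons ?tmu0 // => hj'; first by lia.
  by exists mu.+1 => //; lia.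
by exists mu.+1; [move: hmu => /=; lia | rewrite tmu_cons -hj'; lia].
Qed.

Lemma rank_turns cs : cf_ok cs -> rank cs = size (turns cs).
Proof.
move=> ok; rewrite size_turns // /rank tmu_size.
suff : (2 <= sumn cs)%N by lia.
case/andP: ok; elim: cs => [|c [|d cs] IH] //= ; first by rewrite addn0.
by case/andP=> c0 h l; have := IH h l; rewrite /=; lia.
Qed.

Lemma sum_delta (R : pzRingType) n i (F : nat -> R) :
  \sum_(k < n) (if k == i :> nat then F k else 0) = if (i < n)%N then F i else 0.
Proof.
case: ifP => h; last by rewrite big1 // => k _; case: eqP => // e; rewrite -e ltn_ord in h.
rewrite (bigD1 (Ordinal h)) //= eqxx big1 ?addr0 // => k kh.
by rewrite ifF //; apply: contra_neqF kh => /eqP e; apply: val_inj.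
Qed.

Section Matrix.
Variables (cs : seq nat) (mu : nat -> nat).
Hypothesis mu_end : mu (rank cs) = 0%N.

(** The entries of [m] are even, so [m = 2 mu]. The value 0 of [mu] at [rank cs] spares a special
    case for the last row. *)
Definition doubled : 'cV[int]_(rank cs) := \col_j (mu j).*2%:Z.

Definition mu_prev (j : nat) : int := if j is i.+1 then (mu i)%:Z else 0.

Definition half_row (j : nat) : int :=
  (if is_turn cs j then (mu j)%:Z + (mu j.+1)%:Z else (mu j)%:Z + (mu j)%:Z - (mu j.+1)%:Z)
  - mu_prev j.

Lemma Cmx_doubled (j : 'I_(rank cs)) : (Cmx cs *m doubled) j 0 = half_row j + half_row j.
Proof.
rewrite mxE.
pose D k := (mu k).*2%:Z.
pose d : int := if is_turn cs j then 1 else 2.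
pose e : int := if is_turn cs j then 1 else -1.
(* At [j = 0] the index [j.-1] is [j] itself, hence the guard [0 < j]. *)
transitivity (\sum_(k < rank cs) ((if k == j :> nat then d * D k else 0) +
   (if k == j.+1 :> nat then e * D k else 0) +
   (if k == j.-1 :> nat then (if (0 < j)%N then - D k else 0) else 0))).
  apply: eq_bigr => k _; rewrite !mxE -/(D k) /d /e.
  have -> : (k == j) = (k == j :> nat) by [].
  case: (ltngtP k j) => hk.
  - have -> : (k == j.+1 :> nat) = false by lia.
    have -> : (0 < j)%N by lia.
    have -> : (k.+1 == j :> nat) = (k == j.-1 :> nat) by lia.
    by case: ifP => _; rewrite ?mul0r ?mulN1r add0r ?add0r.
  - have -> : (k.+1 == j :> nat) = false by lia.
    have -> : (k == j.-1 :> nat) = false by lia.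
    by case: ifP => _; rewrite ?mul0r ?addr0 ?add0r.
  - have -> : (k.+1 == j :> nat) = false by lia.
    have -> : (k == j.+1 :> nat) = false by lia.
    rewrite !addr0 -[LHS]addr0; congr (_ + _).
    by case: eqP => // h; rewrite ifF //; lia.
rewrite !big_split.
rewrite (sum_delta _ _ (fun k => d * D k)) (sum_delta _ _ (fun k => e * D k)).
rewrite (sum_delta _ _ (fun k => if (0 < j)%N then - D k else 0)) ltn_ord.
have -> : (if (j.+1 < rank cs)%N then e * D j.+1 else 0) = e * D j.+1.
  case: ifP => // h; have -> : j.+1 = rank cs by have := ltn_ord j; lia.
  by rewrite /D mu_end mulr0.
have -> : (j.-1 < rank cs)%N by have := ltn_ord j; lia.
rewrite /half_row /mu_prev /d /e /D; case: (j : nat) => [|i] /=; case: is_turn; lia.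
Qed.

(* The cross terms of [m^T C m] cancel against those of [fexp] by telescoping. *)
Lemma quadratic_telescope n :
  \sum_(j < n) (mu j)%:Z * half_row j =
  \sum_(j < n) fexp (is_turn cs j) (mu j) (mu j.+1)
  + (mu 0%N)%:Z ^+ 2 - (mu n)%:Z ^+ 2 + mu_prev n * (mu n)%:Z.
Proof.
elim: n => [|n IH]; first by rewrite !big_ord0 /=; ring.
rewrite !big_ord_recr /= IH /half_row /fexp; case: is_turn; ring.
Qed.

Lemma mexp_doubled L : L = (mu 0%N).*2 ->
  mexp L doubled = \sum_(j < rank cs) fexp (is_turn cs j) (mu j) (mu j.+1).
Proof.
move=> ->; rewrite /mexp -mulmxA mxE.
have -> : \sum_(j < rank cs) doubled^T 0 j * (Cmx cs *m doubled) j 0 =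
    (\sum_(j < rank cs) (mu j)%:Z * half_row j) * 4.
  rewrite mulr_suml; apply: eq_bigr => j _; rewrite Cmx_doubled !mxE -muln2 PoszM; ring.
have -> : (mu 0%N).*2%:Z ^+ 2 = (mu 0%N)%:Z ^+ 2 * 4 by rewrite -muln2 PoszM; ring.
by rewrite !mulzK // quadratic_telescope mu_end; ring.
Qed.

Lemma mprod_doubled :
  mprod doubled = \prod_(j < (rank cs).-1)
     qgauss q (ftop (is_turn cs j.+1) (mu j) (mu j.+1) (mu j.+2)) (mu j.+1).*2.
Proof.
pose G j := qgauss q (ftop (is_turn cs j) (mu j.-1) (mu j) (mu j.+1)) (mu j).*2.
transitivity (\prod_(j < rank cs | (0 < j)%N) G j).
  apply: eq_bigr => -[[|j] hj] //= _; rewrite /G Cmx_doubled !mxE /=.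
  rewrite -[gauss _ _]/(qgauss q _ _); congr (qgauss q _ _).
  have -> : ((half_row j.+1 + half_row j.+1) %/ 2)%Z = half_row j.+1 by lia.
  rewrite /half_row /ftop /=; case: is_turn; lia.
case: (rank cs) => [|n]; first by rewrite !big_ord0.
by rewrite big_mkcond big_ord_recl /= mul1r; apply: eq_bigr.
Qed.

Lemma fterm_doubled L : cf_ok cs -> L = (mu 0%N).*2 ->
  q ^ mexp L doubled * mprod doubled = fterm q (turns cs) mu.
Proof.
move=> ok eL; rewrite mexp_doubled // mprod_doubled /fterm -rank_turns //.
congr (q ^ _ * _); apply: eq_bigr => j _; by rewrite is_turn_turns.
Qed.

(* A nonzero product forces [m] to be convex, up to the turns, and it ends at 0. *)
Lemma mprod_decreasing : mprod doubled != 0 ->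
  forall j, (j < rank cs)%N -> (mu j <= mu 0%N)%N.
Proof.
rewrite mprod_doubled => /prodf_neq0 nz.
have dec k : (k < (rank cs))%N -> (mu (rank cs - k) <= mu (rank cs - k.+1))%N.
  elim: k => [|k IH] hk; first by rewrite subn0 mu_end.
  have hj : (rank cs - k.+2 < (rank cs).-1)%N by lia.
  have := nz (Ordinal hj) isT; have := IH (ltnW hk) => /=.
  have -> : (rank cs - k = (rank cs - k.+2).+2)%N by lia.
  have -> : (rank cs - k.+1 = (rank cs - k.+2).+1)%N by lia.
  move=> le1 nz1; rewrite leqNgt; apply: contraNN nz1 => lt1.
  by rewrite qgauss_small // /ftop; case: is_turn; lia.
elim=> [|j IH] hj //; apply: leq_trans (IH (ltnW hj)).
have := dec (rank cs - j.+1)%N.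
by rewrite subKn ?subnSK ?subKn; [apply; lia | lia ..].
Qed.
End Matrix.

(** * From the hypotheses on [cs], [r0] and [s0] to the recursion, and the final comparison of
    sums *)

Lemma cf_ok_cfrac (p p' : nat) cs : (0 < p)%N -> (p < p')%N ->
  is_cfrac cs (p'%:Q / p%:Q) -> cf_ok cs /\ cf_val cs = p'%:R / p%:R.
Proof.
move=> p0 pp [val ge1 l2]; split=> //.
have gt1 : 1 < cf_val cs by rewrite val ltr_pdivlMr ?mul1r ?ltr_nat // ltr0n.
case: cs {val} ge1 l2 gt1 => [|c [|d cs]] //= ge1 l2 gt1.
  by rewrite /cf_ok /= l2 andbT; lia.
have okd : cf_ok (d :: cs).
  rewrite /cf_ok l2 andbT; apply/(all_nthP 0%N) => i hi.
  case: (eqVneq i.+1 (size (d :: cs))) => [e|ne].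
    by move: l2; rewrite (last_nth 0%N) -[size _]/((size (d :: cs)).-1) -e /=; lia.
  by have := ge1 i.+1 ltac:(move: hi ne => /=; lia).
have y1 := cf_val_gt1 okd.
rewrite /cf_ok /= -/(all (leq 1) (d :: cs)) l2 andbT; move: okd => /andP[/= -> _]; rewrite andbT.
(* [is_cfrac] leaves [c_0] free; [c_0 = 0] would give the value [1 / y] with [y > 1], which is below
   1. *)
case: c gt1 {ge1} => // ; rewrite add0r -/(cf_val (d :: cs)) div1r => h.
have y0 : 0 < cf_val (d :: cs) by apply: lt_trans y1.
by move: h; rewrite ltNge invf_le1 // ltW.
Qed.

(** Solutions may be shifted to [(r0 - p, s0 - p')] or reflected to [(p - r0, p' - s0)]. Minimality
    against the former gives [s0 < p'], against the latter [2 s0 <= p']. *)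
Lemma half_start (p p' r0 s0 : nat) : (0 < p)%N -> (p < p')%N -> (3 <= p')%N ->
  is_smallest_rs p p' r0 s0 ->
  [/\ (0 < s0)%N, (s0.+1 < p')%N &
   if (p * s0 == p' * r0 + 1)%N then (p * s0 = p' * r0 + 1)%N
   else (p * s0 + 1 = p' * r0)%N].
Proof.
move=> p0 pp p3 [sol small].
have near : (p * s0 = p' * r0 + 1)%N \/ (p * s0 + 1 = p' * r0)%N.
  by move: sol; rewrite -!PoszM; lia.
have below (r s : nat) : (p * s = p' * r + 1)%N \/ (p * s + 1 = p' * r)%N -> (r0 <= r)%N /\ (s0 <= s)%N.
  by move=> h; apply: small; rewrite -!PoszM; lia.
have sp : (s0 < p')%N.
  rewrite ltnNge; apply/negP => hs.
  have h1 : (p * p' <= p * s0)%N by rewrite leq_mul.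
  have hr : (p <= r0)%N.
    rewrite leqNgt; apply/negP => hr.
    have : (p' * r0.+1 <= p' * p)%N by rewrite leq_mul.
    by rewrite mulnS (mulnC p'); lia.
  have [] := below (r0 - p)%N (s0 - p')%N; last by lia.
  have : (p' * p <= p' * r0)%N by rewrite leq_mul.
  by rewrite !mulnBr (mulnC p'); lia.
have h1 : (p * s0.+1 <= p * p')%N by rewrite leq_mul.
have hr : (r0 <= p)%N.
  rewrite leqNgt; apply/negP => hr.
  have : (p' * p.+1 <= p' * r0)%N by rewrite leq_mul.
  by move: h1; rewrite !mulnS (mulnC p'); lia.
have [|_ hs] := below (p - r0)%N (p' - s0)%N.
  have h2 : (p' * r0 <= p' * p)%N by rewrite leq_mul.
  by move: h1 h2; rewrite !mulnBr mulnS (mulnC p'); lia.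
split; [| by lia | by case: eqP => //; lia].
case: s0 near {small sol below sp h1 hs} => // ; rewrite muln0 add0n => -[|e]; first by lia.
by have : (p' %| 1)%N; [rewrite e dvdn_mulr | rewrite dvdn1; lia].
Qed.

Lemma sum_even (V : nmodType) (F : nat -> V) n : (forall s, odd s -> F s = 0) ->
  \sum_(s < n.*2.+1) F s = \sum_(s < n.+1) F s.*2.
Proof.
move=> F0; elim: n => [|n IH]; first by rewrite !big_ord1.
rewrite doubleS 2!big_ord_recr /= IH [RHS]big_ord_recr /= doubleS.
by rewrite (F0 n.*2.+1) ?addr0 //= odd_double.
Qed.

Theorem theorem5p3 (p p' r0 s0 : nat) (cs : seq nat)
    (hp : (0 < p)%N) (hpp' : (p < p')%N) (hp' : (3 <= p')%N)
    (hcop : coprime p p')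
    (hrs : is_smallest_rs p p' r0 s0)
    (hcs : is_cfrac cs (p'%:Q / p%:Q))
    (L : nat) (hL : ~~ odd L) :
  chi p p' s0 s0 s0.+1 L =
  \sum_(m \in mset cs L) q ^ mexp L m * mprod m.
Proof.
have [ok val] := cf_ok_cfrac hp hpp' hcs.
have [s0_gt0 s0_lt near] := half_start hp hpp' hp' hrs.
set ty := (p * s0 == p' * r0 + 1)%N in near.
have eL : L = L./2.*2 by rewrite even_halfK.
set lam := L./2 in eL.
have hs0 : (0 < s0 < p')%N by lia.
have start := start_ok_near hp hpp' hs0 near.
have gq := q_generic.
transitivity (\sum_(m1 < lam.+1) fsum q (turns cs) lam m1).
  have facing : facing_even p p' s0 true = ty by apply: start.1.
  rewrite -[s0.+1]/(faced s0 true) (@chi_pgf _ _ _ ty start s0 true L lam%:Z) //; last by lia.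
  rewrite facing eL sum_even; last first.
    move=> s os; apply: pgf_parity => //; rewrite os !oddD.
    by case: (odd _); case: (odd _).
  (* For [c_0 > 1] the order of summation is reversed, since [m_1] then counts non-scoring
     vertices. *)
  transitivity (\sum_(m1 < lam.+1) half_pgf q p p' s0 ty lam (first_part cs lam m1)).
    rewrite /first_part; case: (head _ _ == _) => //.
    by rewrite (reindex_inj rev_ord_inj) /=; apply: eq_bigr => i _; congr (half_pgf _ _ _ _ _ _ _); lia.
  apply: eq_bigr => m1 _.
  by apply: (half_pgf_fsum (leqnn _) gq hp hpp' hcop hs0 near ok val); rewrite -ltnS.
have rk : rank cs = (size (turns cs)) := rank_turns ok.
case ets : (turns cs) rk => [|t ts] rk.
  (* No rows means [cs = [:: 2]], that is [p' = 2], which is excluded. *)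
  have [c ec] : exists c, cs = [:: c].
    by case: (cs) ok ets => [|c [|d cs']] //= _; [exists c | case: nseq].
  move: ok val ets; rewrite ec /cf_ok /= => /andP[_ c2] val /eqP; rewrite -size_eq0 size_nseq => c0.
  have e2 : c = 2%N by lia.
  have : (p' == 2 * p)%N by rewrite -(eqr_nat rat) natrM -e2 val divfK // pnatr_eq0; lia.
  by move=> /eqP ep; move: hcop hp'; rewrite ep /coprime gcdnMl => /eqP->.
pose mu (x : (size ts).-tuple 'I_lam.+1) := nth 0%N (lam :: map \val x).
pose g x := doubled cs (mu x).
have mu_end x : mu x (rank cs) = 0%N.
  by rewrite /mu nth_default //= size_map size_tuple rk.
rewrite (@fsbig_finType _ _ _ _ g).
- rewrite (eq_bigr (fun m1 : 'I_lam.+1 => 1 * fsum q (t :: ts) lam m1)); last by move=> i _; rewrite mul1r.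
  rewrite (sum_fsum t ts (fun _ => 1)) //; apply: eq_bigr => x _.
  by rewrite mul1r fterm_doubled // ets.
- move=> x y /matrixP exy; apply: eq_from_tnth => i; apply: val_inj.
  have hi : (i.+1 < rank cs)%N by rewrite rk /= ltnS.
  have := exy (Ordinal hi) 0; rewrite !mxE /mu /=.
  by rewrite !(nth_map (tnth x i)) ?size_tuple // -!tnth_nth => -[/double_inj].
- move=> x j /=; rewrite !mxE; case: eqP => [->|_] /=; first by rewrite /mu /= eL.
  by split=> //; rewrite -muln2 PoszM dvdz_mull.
(* Outside the image of [g] the product vanishes: otherwise [mprod_decreasing] bounds all entries by
   [L], which puts [m] into the image. *)
move=> m mm m_out; apply/eqP; rewrite mulf_eq0; apply/orP; right; apply: contraT => nz.
pose nu j := if insub j is Some i then `|m (i : 'I_(rank cs)) 0%R|./2 else 0%N.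
have em : m = doubled cs nu.
  apply/colP => j; rewrite mxE /nu valK; have := mm j; case: eqP => [_ ->|_ [d2 ge0]].
    by rewrite eL /= doubleK.
  move: (m j 0) ge0 d2 => z; case/intP: z => // n _ /dvdzP[k]; lia.
have nu_end : nu (rank cs) = 0%N by rewrite /nu insubF // ltnn.
have nu0 : nu 0%N = lam.
  have r0' : (0 < rank cs)%N by rewrite rk.
  by rewrite /nu insubT /=; have := mm (Ordinal r0'); rewrite /= => ->.
rewrite em in nz; have bound := mprod_decreasing nu_end nz.
pose x : (size ts).-tuple 'I_lam.+1 := [tuple inord (nu i.+1) | i < size ts].
have x_nth j (hj : (j < size ts)%N) : nth 0%N (map \val x) j = nu j.+1.
  rewrite (nth_map (inord 0)) ?size_tuple // -[j]/(nat_of_ord (Ordinal hj)) -tnth_nth.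
  by rewrite tnth_mktuple /= inordK // ltnS -nu0 bound // rk ltnS.
case: (m_out x); rewrite em.
apply/colP => j; rewrite !mxE /mu; case: j => -[|j] hj; first by rewrite nu0.
by rewrite -[nu _](x_nth j) //; move: hj; rewrite rk.
Qed.
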